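(* Let $A_{\mathsf T}$ be the tiling algebra of a tiling $\mathsf T$. The AG-invariant of $A_{\mathsf T}$ is as follows: (1) There is an ordered pair $(0,c)$ in $AG(A_{\mathsf T})$ if and only if there is a closed tile in $\mathsf T$ with length $c$. (2) There is only one ordered pair $(a,b)$ in $AG(A_{\mathsf T})$ with $a\neq 0$. Moreover, $a$ is the number of open tiles in $\mathsf T$, and $$b=\sum_{\mathcal T \text{ open tile in }\mathsf T}(\ell(\mathcal T)-1)=-a+\sum_{\mathcal T\text{ open tile in }\mathsf T}\ell(\mathcal T).$$
   Context: Let $\mathcal P$ be a disc with at least two marked points on its boundary. A tiling $\mathsf T$ of $\mathcal P$ is given by a collection of pairwise noncrossing interior diagonals (arcs joining two distinct marked points; interior arcs joining neighbouring marked points are allowed); the regions they cut out are the tiles. The length $\ell(\mathcal T)$ of a tile is the number of interior diagonals bounding it. A tile is closed if bounded only by interior diagonals, open otherwise. The tiling algebra $A_{\mathsf T}=\mathbf k Q_{\mathsf T}/\mathsf I_{\mathsf T}$ ($\mathbf k$ an algebraically closed field): vertices of $Q_{\mathsf T}$ are the interior diagonals; there is an arrow $\alpha\to\beta$ whenever $\alpha,\beta$ share a marked point $x$, belong to the same tile and the minimal-angle rotation around $x$ from $\alpha$ to $\beta$ is clockwise; $\mathsf I_{\mathsf T}$ is generated by compositions of two successive arrows from the same tile. Tiling algebras are assumed connected. They are gentle, and all cycles of the quiver are oriented and relation-full (every pair of consecutive arrows is a relation). Threads of a gentle algebra $\mathbf kQ/I$ (paths read from left to right, $s,t$ denoting source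 and target). A non-trivial permitted thread is a maximal path of length $\ge1$ containing no relation. If a vertex $v$ has valency one, or is the source of exactly one arrow $\beta$ and target of exactly one arrow $\alpha$ with $\alpha\beta\notin I$, there is a trivial permitted thread $p_v$. A forbidden path is a path $\alpha_1\cdots\alpha_k$ of pairwise distinct arrows with all $\alpha_i\alpha_{i+1}\in I$; a maximal one is a non-trivial forbidden thread. If $v$ has valency one, or is the source of exactly one arrow $\beta$ and target of exactly one arrow $\alpha$ with $\alpha\beta\in I$, there is a trivial forbidden thread $f_v$. Given a permitted thread $H$, the forbidden thread ending at $t(H)$ from the opposite direction to $H$ is: if $t(H)$ is the target of two arrows $\alpha,\beta$ with $\alpha$ the final arrow of $H$, the forbidden thread with final arrow $\beta$; if $t(H)$ is the target of at most one arrow $\alpha$: when $\alpha$ exists and $H$ does not contain it, the forbidden thread with final arrow $\alpha$; otherwise $f_{t(H)}$. Given a forbidden thread $F$, the permitted thread starting at $s(F)$ in the opposite direction to $F$ is defined in a similar manner (with sources and first arrows; it is $p_{s(F)}$ in the remaining case). The AG-invariant $AG(\mathbf kQ/I)$ consists of the ordered pairs generated by the following algorithm: start with a permitted thread $H_0$; let $F_i$ be the forbidden thread ending at $t(H_i)$ from the opposite direction to $H_i$, and $H_{i+1}$ the permitted thread starting at $s(F_i)$ in the opposite direction to $F_i$; continue until the first permitted thread appears again, i.e. $H_a=H_0$; this gives the pair $(a,b)$, with $b$ the number of arrows used in the forbidden threads $F_i$. Repeat until every permitted thread has appeared. Finally, for each oriented relation-full cycle of length $c$ add a pair $(0,c)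$.
   Formalization: For a tiling with a single diagonal (quiver an isolated vertex) the stated definition yields no threads, so (2) fails; here a vertex of valency zero is given two trivial permitted and two trivial forbidden threads, so that the AG-invariant is (2,0). *)

(* Defs.v *)
From mathcomp Require Import all_boot all_order all_algebra.
From mathcomp Require Import finmap monalg.
From mathcomp Require Import boolp.

Set Implicit Arguments.
Unset Strict Implicit.
Unset Printing Implicit Defensive.

Import GRing.Theory.

Record quiver := Quiver {
  vertex : finType;
  arrow : finType;
  src : arrow -> vertex;
  tgt : arrow -> vertex }.

Section Paths.
Variable Q : quiver.
Implicit Types (a b : arrow Q) (v : vertex Q).

Definition arrows_into v := [set a : arrow Q | tgt a == v].
Definition arrows_from v := [set a : arrow Q | src a == v].

(* loops count twice *)
Definition valency v := #|arrows_into v| + #|arrows_from v|.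

Definition composable a b := tgt a == src b.

(* A path is given by its source and its arrows, read from left to right, so
   that (v, [::]) is the trivial path at v. *)
Definition is_path (p : vertex Q * seq (arrow Q)) : bool :=
  if p.2 is a :: s then (src a == p.1) && path composable a s else true.

Definition qpath := {p : vertex Q * seq (arrow Q) | is_path p}.

Definition path_src (p : vertex Q * seq (arrow Q)) : vertex Q := p.1.
Definition path_tgt (p : vertex Q * seq (arrow Q)) : vertex Q :=
  last p.1 [seq tgt a | a <- p.2].

Definition path_cat (p q : qpath) : option qpath :=
  if path_tgt (val p) == path_src (val q)
  then insub ((val p).1, (val p).2 ++ (val q).2) else None.

Lemma is_path_arrow a : is_path (src a, [:: a]).
Proof. by rewrite /is_path /= eqxx. Qed.

Definition arrow_path a : qpath := exist _ (src a, [:: a]) (is_path_arrow a).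

Definition connected_quiver : bool :=
  (0 < #|vertex Q|) &&
  [forall v, forall w,
     connect (fun v w => [exists a : arrow Q,
       ((src a == v) && (tgt a == w)) || ((src a == w) && (tgt a == v))]) v w].

End Paths.

Section PathAlgebra.
Local Open Scope ring_scope.
Variables (k : fieldType) (Q : quiver).

Definition path_algebra := {malg k[qpath Q]}.

Definition path_mul (x y : path_algebra) : path_algebra :=
  \sum_(p <- msupp x) \sum_(q <- msupp y)
     (if path_cat p q is Some r then << x@_p * y@_q *g r >> else 0).

Definition arrow_elt (a : arrow Q) : path_algebra := << arrow_path a >>.

(* The two-sided ideal generated by S. Closure under scalars follows from
   closure under multiplication, the trivial paths summing to the unit. *)
Inductive ideal_gen (S : path_algebra -> Prop) : path_algebra -> Prop :=
| ideal_gen_in x of S x : ideal_gen S x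
| ideal_gen_0 : ideal_gen S 0
| ideal_gen_add x y of ideal_gen S x & ideal_gen S y : ideal_gen S (x + y)
| ideal_gen_mull x y of ideal_gen S y : ideal_gen S (path_mul x y)
| ideal_gen_mulr x y of ideal_gen S x : ideal_gen S (path_mul x y).

End PathAlgebra.

(* The algebra kQ/I, given by its presentation. *)
Record quiver_algebra (k : fieldType) := QuiverAlgebra {
  quiver_of :> quiver;
  ideal_of : path_algebra k quiver_of -> Prop }.

Section AG.
Variables (k : fieldType) (A : quiver_algebra k).
Implicit Types (a b : arrow A) (v : vertex A).

Definition in_ideal a b : bool :=
  `[< ideal_of (path_mul (arrow_elt k a) (arrow_elt k b)) >].

Definition permitted_step a b := composable a b && ~~ in_ideal a b.
Definition forbidden_step a b := composable a b && in_ideal a b.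

Definition permitted_path (s : seq (arrow A)) : bool :=
  if s is a :: s' then path permitted_step a s' else false.
Definition forbidden_path (s : seq (arrow A)) : bool :=
  if s is a :: s' then path forbidden_step a s' && uniq s else false.

(* Subpaths of permitted (forbidden) paths are permitted (forbidden), so
   maximality may be tested on extensions by one arrow. *)
Definition maximal_path (P : pred (seq (arrow A))) (s : seq (arrow A)) : bool :=
  P s && [forall a, ~~ P (a :: s) && ~~ P (rcons s a)].

(* A thread is a path (v, s) together with a sign. Bounding the length of s by
   the number of arrows loses nothing: arrows are pairwise distinct in a
   forbidden path by definition, and also in a maximal permitted path of a
   gentle algebra, which could be prolonged forever if it repeated an arrow.
   The sign is false, except that at a vertex of valency zero there are two
   trivial permitted and two trivial forbidden threads, one of each sign (see
   [trivial_signs]). *)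
Definition thread : Type :=
  (vertex A * #|arrow A|.-bseq (arrow A) * bool)%type.

Definition thread_src (H : thread) : vertex A := H.1.1.
Definition thread_arrows (H : thread) : seq (arrow A) := H.1.2.
Definition thread_sign (H : thread) : bool := H.2.
Definition thread_tgt (H : thread) : vertex A :=
  path_tgt (thread_src H, thread_arrows H).

Definition trivial_thread v (e : bool) : thread := (v, [bseq], e).

Definition first_arrow (H : thread) : option (arrow A) :=
  ohead (thread_arrows H).
Definition final_arrow (H : thread) : option (arrow A) :=
  ohead (rev (thread_arrows H)).

Definition crossing_vertex (R : rel (arrow A)) v : bool :=
  [exists a, exists b,
     [&& arrows_into v == [set a], arrows_from v == [set b] & R a b]].

(* A gentle algebra has two permitted threads, and two forbidden ones, through
   each vertex. A vertex of valency zero occurs, in a connected quiver, only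
   for the algebra k; with both trivial threads counted there, AG(k) is
   {(2, 0)}, in line with {(n+1, n-1)} for the quivers of type A_n. *)
Definition trivial_signs (R : rel (arrow A)) v (e : bool) : bool :=
  (valency v == 0) || (((valency v == 1) || crossing_vertex R v) && ~~ e).

Definition is_thread (P : pred (seq (arrow A))) (R : rel (arrow A))
    (H : thread) : bool :=
  if thread_arrows H is [::] then trivial_signs R (thread_src H) (thread_sign H)
  else [&& is_path (thread_src H, thread_arrows H),
           maximal_path P (thread_arrows H) & ~~ thread_sign H].

Definition permitted_thread := is_thread permitted_path permitted_step.
Definition forbidden_thread := is_thread forbidden_path forbidden_step.

(* The forbidden thread ending at t(H) from the opposite direction to H. When
   H is non-trivial its final arrow ends at t(H), so for two as for at most one
   arrow ending at t(H) the relevant one is the arrow ending at t(H) which is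
   not the final arrow of H. *)
Definition next_forbidden (H : thread) : thread :=
  if [pick b | (tgt b == thread_tgt H) && (final_arrow H != Some b)] is Some b
  then odflt H [pick F | forbidden_thread F && (final_arrow F == Some b)]
  else trivial_thread (thread_tgt H) (thread_sign H).

(* The permitted thread starting at s(F) in the opposite direction to F. At a
   vertex of valency zero it is the trivial one of the other sign. *)
Definition next_permitted (F : thread) : thread :=
  if [pick b | (src b == thread_src F) && (first_arrow F != Some b)] is Some b
  then odflt F [pick H | permitted_thread H && (first_arrow H == Some b)]
  else trivial_thread (thread_src F)
         ((valency (thread_src F) == 0) && ~~ thread_sign F).

Definition AG_step (H : thread) : thread := next_permitted (next_forbidden H).

(* The sets {H_0, ..., H_(a-1)} of permitted threads met by the successive runs
   of the algorithm. *)
Definition AG_runs : {set {set thread}} :=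
  [set [set H in orbit AG_step H0] | H0 : thread & permitted_thread H0].

Definition run_pair (run : {set thread}) : nat * nat :=
  (#|run|, \sum_(H in run) size (thread_arrows (next_forbidden H))).

(* Oriented relation-full cycles, up to rotation. In a gentle algebra an arrow
   a has at most one b with ab a relation, so such a cycle is determined by its
   set of arrows. *)
Definition full_cycles : {set {set arrow A}} :=
  [set [set a in c] | c : #|arrow A|.-bseq (arrow A) &
     [&& (0 < size c), uniq c & cycle forbidden_step c]].

(* The AG-invariant as a multiset: the order of the list is irrelevant. *)
Definition AG : seq (nat * nat) :=
  [seq run_pair run | run <- enum AG_runs] ++
  [seq (0, #|C|) | C : {set arrow A} <- enum full_cycles].

End AG.

(* The marked points are the elements of 'I_n, numbered clockwise along the
   boundary of the disc. *)

Definition cwdist n (x y : 'I_n) : nat := (y + n - x) %% n.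

(* An interior diagonal is determined, up to isotopy, by its endpoints; it may
   join neighbouring marked points, and is then still distinct from the
   boundary segment between them. *)
Definition diagonal n := {set 'I_n}.

Definition crossing n (d e : diagonal n) : bool :=
  [exists x : 'I_n, exists y : 'I_n, exists z : 'I_n, exists w : 'I_n,
     [&& x < y, y < z, z < w, d == [set x; z] & e == [set y; w]]].

Definition is_tiling n (T : {set diagonal n}) : bool :=
  [forall d in T, #|d| == 2] && [forall d in T, forall e in T, ~~ crossing d e].

(* The sides of the tiles: [inl i] is the boundary segment from i clockwise to
   the next marked point, seen from inside the disc; [inr (x, y)] is the
   diagonal {x, y} seen from its right when travelling from x to y, that is,
   from the part of the disc adjacent to the boundary from y clockwise to x. *)
Definition side n := ('I_n + 'I_n * 'I_n)%type.

Definition sides n (T : {set diagonal n}) : {set side n} :=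
  [set s | if s is inr (x, y) then [set x; y] \in T else true].

(* Whether the side s faces a point of the half-disc bounded by the diagonal
   {a, b} and by the boundary from a clockwise to b. *)
Definition faces_half n (a b : 'I_n) (s : side n) : bool :=
  match s with
  | inl i => cwdist a i < cwdist a b
  | inr (x, y) =>
      if (x, y) == (b, a) then true else
      if (x, y) == (a, b) then false else
      (cwdist a x <= cwdist a b) && (cwdist a y <= cwdist a b)
  end.

(* Two points of the disc are in the same region iff no diagonal separates
   them; a tile is encoded as the set of its sides. *)
Definition same_tile n (T : {set diagonal n}) (s t : side n) : bool :=
  [forall a, forall b,
     ([set a; b] \in T) ==> (faces_half a b s == faces_half a b t)].

Definition tiles n (T : {set diagonal n}) : {set {set side n}} :=
  equivalence_partition (same_tile T) (sides T).

Definition bounds n (d : diagonal n) (tau : {set side n}) : bool :=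
  [exists x, exists y, (d == [set x; y]) && (inr (x, y) \in tau)].

Definition tile_length n (T : {set diagonal n}) (tau : {set side n}) : nat :=
  #|[set d in T | bounds d tau]|.

Definition closed_tile n (tau : {set side n}) : bool :=
  [forall i : 'I_n, inl i \notin tau].

Definition closed_tiles n (T : {set diagonal n}) : {set {set side n}} :=
  [set tau in tiles T | closed_tile tau].
Definition open_tiles n (T : {set diagonal n}) : {set {set side n}} :=
  [set tau in tiles T | ~~ closed_tile tau].

Section TilingAlgebra.
Variables (n : nat) (T : {set diagonal n}).

(* Inside the disc, the rotation around x taking {x, y} to {x, z} is clockwise
   iff y precedes z when walking clockwise along the boundary from x. *)
Definition is_tiling_arrow (d e : diagonal n) : bool :=
  [exists x, exists y, exists z,
     [&& d == [set x; y], e == [set x; z], cwdist x y < cwdist x z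
       & [exists tau in tiles T, bounds d tau && bounds e tau]]].

Definition tiling_vertex := {d : diagonal n | d \in T}.
Definition tiling_arrow :=
  {de : tiling_vertex * tiling_vertex
      | is_tiling_arrow (val de.1) (val de.2)}.

Definition tiling_quiver : quiver :=
  @Quiver tiling_vertex tiling_arrow
    (fun a => (val a).1) (fun a => (val a).2).

Definition arrow_in_tile (tau : {set side n}) (a : arrow tiling_quiver) : bool :=
  bounds (val (src a)) tau && bounds (val (tgt a)) tau.

Definition tiling_relations (k : fieldType)
    (x : path_algebra k tiling_quiver) : Prop :=
  exists a b : arrow tiling_quiver,
    [/\ composable a b,
        [exists tau in tiles T, arrow_in_tile tau a && arrow_in_tile tau b]
      & x = path_mul (arrow_elt k a) (arrow_elt k b)].

Definition tiling_algebra (k : fieldType) : quiver_algebra k :=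
  QuiverAlgebra (ideal_gen (@tiling_relations k)).

End TilingAlgebra.

(* Main.v *)
Require Import Defs.
From mathcomp Require Import all_boot all_order all_algebra.
From mathcomp Require Import finmap monalg boolp.
From mathcomp Require Import zify.

(* Walking around a tile with the tile on the right permutes the sides, and the
   arrows of the quiver are the corners between two consecutive diagonal sides,
   each going against the walk. A composition of two arrows is a relation iff it
   follows the sides of a single tile, and is not iff both arrows turn around the
   same marked point. Thus full cycles are the closed tiles, permitted threads are
   the rotations around the marked points x at which some diagonal ends (the
   occupied points), and the forbidden thread following the one at x runs through
   the diagonals of the tile containing the boundary segment before x.

   If an open tile has boundary segments ij and kl, no diagonal joins the two
   parts of the boundary between them, so by connectedness of the quiver one part
   contains no occupied point. Hence the boundary segments of an open tile are
   consecutive, each open tile has the boundary segment before x for exactly one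
   occupied x, and a step of the algorithm moves from x to the preceding occupied
   point. Therefore all permitted threads form one run, of length the number of
   open tiles, and the tile of x contributes its length minus one. *)

Set Implicit Arguments.
Unset Strict Implicit.
Unset Printing Implicit Defensive.

Import GRing.Theory.

(** * Ideals generated by paths of length two *)

Section MonomialIdeal.
Local Open Scope ring_scope.
Variables (k : fieldType) (Q : quiver) (r : rel (arrow Q)).
Implicit Types (x y : path_algebra k Q) (a b : arrow Q) (p q : qpath Q).

Definition relation_free p := sorted (fun a b => ~~ r a b) (val p).2.

Definition relation_supported x := forall p, relation_free p -> x@_p = 0.

Lemma path_catE p q c : path_cat p q = Some c -> (val c).2 = (val p).2 ++ (val q).2.
Proof.
rewrite /path_cat; case: ifP => // _.
by case: insubP => // u _ e [<-]; rewrite e.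
Qed.

Lemma path_mul_coeff0 x y c :
  (forall p q, p \in msupp x -> q \in msupp y -> path_cat p q <> Some c) ->
  (path_mul x y)@_c = 0.
Proof.
move=> h; rewrite /path_mul.
have D u v : u@_c = 0 -> v@_c = 0 -> (u + v : path_algebra k Q)@_c = 0.
  by move=> u0 v0; rewrite mcoeffD u0 v0 addr0.
rewrite big_seq; apply: (big_ind (fun z : path_algebra k Q => z@_c = 0)) => //.
  exact: mcoeff0.
move=> p px; rewrite big_seq.
apply: (big_ind (fun z : path_algebra k Q => z@_c = 0)) => //; first exact: mcoeff0.
move=> q qy; have := h p q px qy; case: path_cat => [d|] e; last exact: mcoeff0.
by rewrite mcoeffU; case: eqP => // dc; rewrite dc in e.
Qed.

Lemma path_mul_basis p q c : path_cat p q = Some c ->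
  path_mul << p >> << q >> = (<< c >> : path_algebra k Q).
Proof.
move=> e.
have E x y : msupp x = [fset p]%fset -> msupp y = [fset q]%fset ->
    x@_p = 1 -> y@_q = 1 -> path_mul x y = << c >>.
  move=> xp yq xp1 yq1; rewrite /path_mul xp yq big_seq_fset1 big_seq_fset1 e.
  by rewrite xp1 yq1 mulr1.
apply: E; rewrite ?mcoeffUU //.
  by rewrite msuppU oner_eq0.
by rewrite msuppU oner_eq0.
Qed.

Lemma path_mul_arrows a b : composable a b ->
  exists2 c : qpath Q, (val c).2 = [:: a; b] &
    path_mul (arrow_elt k a) (arrow_elt k b) = << c >>.
Proof.
move=> ab; have pc : is_path (src a, [:: a; b]) by rewrite /is_path /= eqxx ab.
pose c : qpath Q := Sub (src a, [:: a; b]) pc; apply: (ex_intro2 _ _ c) => //.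
apply: path_mul_basis; rewrite /path_cat /= /path_tgt /path_src /= (eqP ab) eqxx.
by rewrite (insubT (@is_path Q) pc).
Qed.

(** The two factors of a relation-free path are relation-free, and one of them has coefficient
    zero. *)
Lemma relation_supported_mul x y :
  relation_supported x \/ relation_supported y -> relation_supported (path_mul x y).
Proof.
move=> xy c; rewrite /relation_free => fc; apply: path_mul_coeff0 => p q px qy.
move/path_catE => e; move: fc; rewrite e => fc.
have fp : relation_free p.
  by case: (cat_sorted2 fc).
have fq : relation_free q.
  by case: (cat_sorted2 fc).
case: xy => [/(_ p fp)|/(_ q fq)] /eqP; rewrite mcoeff_eq0.
- by rewrite px.
- by rewrite qy.
Qed.

(** The elements supported on paths through a relation contain the generators and are closed under
    all operations of the ideal, whereas a path ab outside [r] is not one of them. *)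
Lemma ideal_gen_relation (S : path_algebra k Q -> Prop) :
  (forall x, S x -> exists a b, [/\ composable a b, r a b
      & x = path_mul (arrow_elt k a) (arrow_elt k b)]) ->
  forall a b, composable a b ->
    ideal_gen S (path_mul (arrow_elt k a) (arrow_elt k b)) -> r a b.
Proof.
move=> gS a b ab Iab.
suff sS x : ideal_gen S x -> relation_supported x.
  have [c cE pE] := path_mul_arrows ab.
  have := sS _ Iab c; rewrite pE mcoeffUU /relation_free cE /= andbT.
  case: (r a b) => // /(_ isT) /eqP; by rewrite oner_eq0.
elim=> [{}x /gS[c [d [cd rcd ->]]]||u v _ su _ sv|u v _ sv|u v _ su].
- have [p pE ->] := path_mul_arrows cd.
  move=> q; rewrite mcoeffU; case: eqP => // <-.
  by rewrite /relation_free pE /= rcd.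
- by move=> p _; rewrite mcoeff0.
- by move=> p fp; rewrite mcoeffD su // sv // addr0.
- by apply: relation_supported_mul; right.
- by apply: relation_supported_mul; left.
Qed.

End MonomialIdeal.

(** * Vertices without arrows *)

Section Valency.
Variable Q : quiver.
Implicit Types (a : arrow Q) (v : vertex Q).

Lemma valency0_into v a : valency v = 0 -> a \notin arrows_into v.
Proof.
move/eqP; rewrite addn_eq0 => /andP[/eqP/cards0_eq v0 _].
by rewrite v0 in_set0.
Qed.

Lemma valency0_from v a : valency v = 0 -> a \notin arrows_from v.
Proof.
move/eqP; rewrite addn_eq0 => /andP[_ /eqP/cards0_eq v0].
by rewrite v0 in_set0.
Qed.

Lemma valency0I v : (forall a, a \notin arrows_into v) ->
  (forall a, a \notin arrows_from v) -> valency v = 0.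
Proof.
move=> iv fv; have -> : valency v = #|arrows_into v| + #|arrows_from v| by [].
have -> : arrows_into v = set0 by apply/setP => a; rewrite in_set0; apply/negbTE.
have -> : arrows_from v = set0 by apply/setP => a; rewrite in_set0; apply/negbTE.
by rewrite cards0.
Qed.

End Valency.

Lemma card_full_cycleP (k : fieldType) (A : quiver_algebra k) (m : nat) :
  (exists2 C, C \in full_cycles A & #|C| = m) <->
  (exists l : seq (arrow A), [/\ 0 < size l, uniq l,
     cycle (@forbidden_step k A) l & size l = m]).
Proof.
split=> [[C /imsetP[c]]|[l [l0 ul cl <-]]].
  rewrite inE => /and3P[c0 uc cc] -> <-; exists c; split=> //.
  by rewrite cardsE (card_uniqP uc).
have hl : size l <= #|arrow A| by rewrite -(card_uniqP ul); apply: max_card.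
exists [set a in Bseq hl]; last by rewrite cardsE (card_uniqP ul).
by apply/imsetP; exists (Bseq hl); rewrite ?inE ?l0 ?ul ?cl.
Qed.

(** * Maximal paths *)

Section MaximalPaths.
Variables (A : finType) (R : rel A).
Implicit Types (a b c : A) (s t : seq A) (P : pred (seq A)).

(** Prolonging at the end must stop, as sizes are bounded. The predicate is arbitrary so that the
    lemma also serves reversed paths, which grow at their start. *)
Lemma max_extension P a : (forall s, P s -> size s <= #|A|) -> P [:: a] ->
  exists s, P (a :: s) /\ forall c, ~~ P (rcons (a :: s) c).
Proof.
move=> sP; move: [::] => s; have [m] := ubnP (#|A| - size s).
elim: m s => // m IH s sm Ps.
case: (pickP (fun c => P (rcons (a :: s) c))) => [c Psc|no]; last first.
  by exists s; split=> // c; rewrite no.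
by apply: (IH (rcons s c)) => //; move: (sP _ Psc); rewrite /= !size_rcons;
  move: (#|A|) sm => N; lia.
Qed.

Lemma path_closed (D : pred A) a s : (forall b c, R b c -> D b -> D c) ->
  path R a s -> D a -> forall b, b \in a :: s -> D b.
Proof.
move=> RD; elim: s a => [|c s IH] a /=.
  by move=> _ Da b; rewrite inE => /eqP ->.
by case/andP=> ac cs Da b; rewrite inE => /predU1P[-> //|];
  apply: IH cs (RD _ _ ac Da) b.
Qed.

Lemma path_prev a s b : path R a s -> b \in s -> exists2 c, c \in a :: s & R c b.
Proof.
elim: s a => //= c s IH a /andP[ac cs]; rewrite inE => /predU1P[->|bs].
  by exists a; rewrite ?mem_head.
by have [d ds db] := IH c cs bs; exists d; rewrite // inE ds orbT.
Qed.

Lemma path_next a s b : path R a s -> b \in a :: s ->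
  b = last a s \/ exists2 c, c \in s & R b c.
Proof.
elim: s a => [|c s IH] a /=; first by move=> _; rewrite inE => /eqP ->; left.
case/andP=> ac cs; rewrite inE => /predU1P[->|bs].
  by right; exists c; rewrite ?mem_head.
case: (IH c cs bs) => [|[d ds bd]]; first by left.
by right; exists d; rewrite // inE ds orbT.
Qed.

Lemma path_functional_prefix a s t : (forall b c d, R b c -> R b d -> c = d) ->
  path R a s -> path R a t -> size s <= size t -> exists u, t = s ++ u.
Proof.
move=> Rf; elim: s a t => [|c s IH] a t /=; first by exists t.
case: t => //= d t /andP[ac cs] /andP[ad dt]; rewrite ltnS => l.
have e := Rf _ _ _ ac ad; subst d.
by have [u ->] := IH c t cs dt l; exists u.
Qed.

(** Steps being determined, one path is a prefix of the other, and maximality rules out a proper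
    prefix. *)
Lemma maximal_path_uniq P a s t : (forall b c d, R b c -> R b d -> c = d) ->
  (forall s, P s = if s is b :: s' then path R b s' else false) ->
  P (a :: s) -> P (a :: t) ->
  (forall c, ~~ P (rcons (a :: s) c)) -> (forall c, ~~ P (rcons (a :: t) c)) ->
  s = t.
Proof.
move=> Rf PE; wlog l : s t / size s <= size t.
  move=> W Ps Pt ms mt; case: (leqP (size s) (size t)) => [|/ltnW] l; first exact: W.
  by symmetry; apply: W.
rewrite !PE => ps pt ms _; have [[|c u] ut] := path_functional_prefix Rf ps pt l.
  by rewrite ut cats0.
have := ms c; rewrite PE /= -cats1 cat_path ps /=.
by move: pt; rewrite ut cat_path /= => /and3P[_ ->].
Qed.

End MaximalPaths.

(** * Sides of tiles *)

Section Clockwise.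
Variable n : nat.
Implicit Types (x y z : 'I_n).

Lemma cwdistP x y :
  (x <= y /\ cwdist x y + x = y) \/ (y < x /\ cwdist x y + x = y + n).
Proof.
have [xn yn] := (ltn_ord x, ltn_ord y); rewrite /cwdist.
case: (leqP x y) => xy; [left | right]; split=> //.
- have -> : y + n - x = (y - x) + n by lia.
  by rewrite modnDr modn_small; lia.
- by rewrite modn_small; lia.
Qed.

Lemma cwdist_inj x : injective (cwdist x).
Proof.
move=> y z e; apply: val_inj => /=.
have [yn zn] := (ltn_ord y, ltn_ord z).
by move: (cwdistP x y) (cwdistP x z); rewrite e; lia.
Qed.

Lemma cwdist_eq x y z : (cwdist x y == cwdist x z) = (y == z).
Proof. exact: (inj_eq (@cwdist_inj x)). Qed.

Lemma cwdistxx x : cwdist x x = 0.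
Proof. by move: (cwdistP x x); lia. Qed.

Lemma cwdist_eq0 x y : (cwdist x y == 0) = (y == x).
Proof. by rewrite -{1}(cwdistxx x) cwdist_eq. Qed.

Lemma cwdist_lt x y : cwdist x y < n.
Proof. by move: (cwdistP x y) (ltn_ord x) (ltn_ord y); lia. Qed.

Lemma cwdist_ordS x : 1 < n -> cwdist x (ordS x) = 1.
Proof.
move=> n1; have xn := ltn_ord x.
have sE : (ordS x : nat) = x.+1 %% n by [].
move: (cwdistP x (ordS x)); rewrite sE.
case: (ltngtP x.+1 n) => [h|h|h]; [rewrite modn_small // | | rewrite h modnn]; lia.
Qed.

End Clockwise.

(** Replaces every clockwise distance by a number subject to the two cases of [cwdistP], which
    leaves a problem of linear arithmetic. *)
Ltac cwlia :=
  repeat match goal with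
  | H : context [cwdist ?x ?y] |- _ =>
    let r := fresh "r" in
    pose proof (cwdistP x y); set (r := cwdist x y) in *; clearbody r
  | |- context [cwdist ?x ?y] =>
    let r := fresh "r" in
    pose proof (cwdistP x y); set (r := cwdist x y) in *; clearbody r
  end;
  repeat match goal with
  | x : 'I_?n |- _ =>
    lazymatch goal with
    | _ : is_true (nat_of_ord x < n) |- _ => fail
    | |- _ => pose proof (ltn_ord x)
    end
  end;
  lia.

Section Tiling.
Variables (n : nat) (T : {set diagonal n}).
Hypotheses (n_ge2 : 1 < n) (tilT : is_tiling T).
Section Sides.
Implicit Types (x y z a b c d w i j q : 'I_n) (s t u : side n).

Definition joined x y := [set x; y] \in T.

Lemma joinedC x y : joined x y = joined y x.
Proof. by rewrite /joined setUC. Qed.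

Lemma joined_neq x y : joined x y -> x != y.
Proof.
move=> xy; case/andP: tilT => /forall_inP/(_ _ xy) + _.
by apply: contraTneq => ->; rewrite setUid cards1.
Qed.

Lemma cwdist_joined x y : joined x y -> 0 < cwdist x y.
Proof. by move=> /joined_neq; rewrite lt0n cwdist_eq0 eq_sym. Qed.

Lemma noncrossing a b c d : joined a b -> joined c d ->
  0 < cwdist a c < cwdist a b -> cwdist a d <= cwdist a b.
Proof.
move=> ab cd acb; rewrite leqNgt; apply/negP => abd.
case/andP: tilT => _ /forall_inP nX.
(* A crossing lists its endpoints in increasing order, so the cases below find the rotation of the
   cyclic order a, c, b, d that begins with the least number. *)
have X x y z w : x < y -> y < z -> z < w -> joined x z -> joined y w -> False.
  move=> xy yz zw xz yw; move/forall_inP: (nX _ xz) => /(_ _ yw)/negP; apply.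
  apply/existsP; exists x; apply/existsP; exists y; apply/existsP; exists z.
  by apply/existsP; exists w; rewrite xy yz zw !eqxx.
have [ba dc] : joined b a /\ joined d c by rewrite !(joinedC _ a) !(joinedC d).
case: (boolP (a < c)) => ac.
  case: (boolP (c < b)) => cb.
    case: (boolP (b < d)) => bd; first exact: (X a c b d).
    by apply: (X d a c b) => //; cwlia.
  by apply: (X b d a c) => //; cwlia.
by apply: (X c b d a) => //; cwlia.
Qed.

Definition tail s := match s with inl i => i | inr (x, y) => x end.
Definition head s := match s with inl i => ordS i | inr (x, y) => y end.

(* Around a marked point x the boundary segments starting and ending at x have
   ranks 0 and n, and the diagonal {x, y} has rank cwdist x y. *)
Definition outrank s := match s with inl i => 0 | inr (x, y) => cwdist x y end.
Definition inrank s := match s with inl i => n | inr (x, y) => cwdist y x end.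

Lemma sides_inl i : inl i \in sides T.
Proof. by rewrite inE. Qed.

Lemma sides_inr x y : (inr (x, y) \in sides T) = joined x y.
Proof. by rewrite inE. Qed.

Lemma tail_outrank_inj s t : tail s = tail t -> outrank s = outrank t ->
  s \in sides T -> t \in sides T -> s = t.
Proof.
case: s => [i|[x y]]; case: t => [j|[z w]] /= e.
- by rewrite e.
- by move=> r _; rewrite sides_inr => /cwdist_joined; rewrite -r.
- by move=> r; rewrite sides_inr => /cwdist_joined; rewrite -r r.
- by rewrite e => /cwdist_inj ->.
Qed.

Lemma head_inrank_inj s t : head s = head t -> inrank s = inrank t -> s = t.
Proof.
case: s => [i|[x y]]; case: t => [j|[z w]] /= e.
- by move/ordS_inj: e => ->.
- by move=> r; move: (cwdist_lt w z); rewrite -r ltnn.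
- by move=> r; move: (cwdist_lt y x); rewrite r ltnn.
- by rewrite e => /cwdist_inj ->.
Qed.

Lemma inrank_gt0 s : s \in sides T -> 0 < inrank s.
Proof.
case: s => [i|[x y]] /=; first by lia.
by rewrite sides_inr joinedC; apply: cwdist_joined.
Qed.

(** With the tile on the right, the walk turns as sharply right as possible at the head of s: it
    leaves along the side of the next smaller rank, which is the boundary segment, of rank 0, if no
    diagonal comes before it. *)
Definition follows s t :=
  [&& t \in sides T, tail t == head s, outrank t < inrank s &
      [forall w, joined (head s) w ==>
         ~~ (outrank t < cwdist (head s) w < inrank s)]].

(** The identity off [sides T], which makes it a permutation of the whole finite type, inverted by
    [finv]. *)
Definition next_side s := if s \in sides T then odflt s [pick t | follows s t] else s.

Lemma follows_next s : s \in sides T -> follows s (next_side s).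
Proof.
move=> sT; rewrite /next_side sT; case: pickP => [t|/= no]; first by [].
pose P w := joined (head s) w && (cwdist (head s) w < inrank s).
case: (pickP P) => [w0 Pw0|noP].
- case: (@arg_maxnP _ w0 P (cwdist (head s)) Pw0) => w /andP[jw lw] wmax.
  have /negP[] := negbT (no (inr (head s, w))); apply/and4P; split=> //=.
  + by rewrite sides_inr.
  + by apply/forall_inP => v jv; apply/negP => /andP[l1 l2];
      move: (wmax v); rewrite /P jv l2 => /(_ isT); lia.
- have /negP[] := negbT (no (inl (head s))); apply/and4P; split=> //=.
  + exact: sides_inl.
  + exact: inrank_gt0.
  + apply/forall_inP => v jv; apply/negP => /andP[l1 l2].
    by move: (noP v); rewrite /P jv l2.
Qed.

Lemma mem_next_side s : (next_side s \in sides T) = (s \in sides T).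
Proof.
case: (boolP (s \in sides T)) => sT; last by rewrite /next_side (negbTE sT) (negbTE sT).
by case/and4P: (follows_next sT).
Qed.

Lemma tail_next s : s \in sides T -> tail (next_side s) = head s.
Proof. by move=> /follows_next/and4P[_ /eqP]. Qed.

Lemma outrank_next s : s \in sides T -> outrank (next_side s) < inrank s.
Proof. by move=> /follows_next/and4P[_ _]. Qed.

Lemma next_between s w : s \in sides T -> joined (head s) w ->
  ~~ (outrank (next_side s) < cwdist (head s) w < inrank s).
Proof. by move=> /follows_next/and4P[_ _ _ /forall_inP]; apply. Qed.

Lemma follows_eq s t : s \in sides T -> follows s t -> next_side s = t.
Proof.
move=> sT /and4P[tT /eqP tt lt /forall_inP nbt].
have [nT] : next_side s \in sides T by rewrite mem_next_side.
apply: tail_outrank_inj => //; first by rewrite tail_next.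
have {nbt}nbt w := nbt w.
have lt' := outrank_next sT.
case: (ltngtP (outrank (next_side s)) (outrank t)) => // l.
- case: t tT tt lt l nbt => [i|[x y]] //=; rewrite sides_inr => jxy e lt l _.
  by rewrite e in jxy lt l; move: (next_between sT jxy); rewrite l lt.
- have := tail_next sT; case: (next_side s) nT lt' l => [i|[x y]] //=.
  rewrite sides_inr => jxy lt' l e.
  by rewrite e in jxy lt' l; move: (nbt y jxy); rewrite l lt'.
Qed.

(** Of two sides with the same successor, the one of smaller rank would be a diagonal strictly
    between the other side and that successor. *)
Lemma next_side_inj : injective next_side.
Proof.
move=> s t e.
have sT_tT : (s \in sides T) = (t \in sides T).
  by rewrite -(mem_next_side s) e mem_next_side.
case: (boolP (s \in sides T)) => sT; last first.
  have := sT; rewrite sT_tT => tT; move: e.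
  by rewrite /next_side (negbTE sT) (negbTE tT).
have tT : t \in sides T by rewrite -sT_tT.
have hE : head s = head t by rewrite -!tail_next // e.
apply: head_inrank_inj => //.
wlog l : s t e sT_tT sT tT hE / inrank s < inrank t.
  move=> W; case: (ltngtP (inrank s) (inrank t)) => // l.
  - by apply: W.
  - by symmetry; apply: W => //; rewrite ?hE.
have := outrank_next sT; rewrite e.
case: s sT l {e sT_tT} hE => [i|[x y]] /=.
  case: t tT => [j|[z w]] _ /=; first by rewrite ltnn.
  by move: (cwdist_lt w z); lia.
rewrite sides_inr joinedC => jxy l hE l'.
by rewrite hE in jxy l' l; move: (next_between tT jxy); rewrite l l'.
Qed.

Definition prev_side := finv next_side.

Lemma next_sideK : cancel next_side prev_side.
Proof. exact: finv_f next_side_inj. Qed.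

Lemma prev_sideK : cancel prev_side next_side.
Proof. exact: f_finv next_side_inj. Qed.

Lemma prev_side_inj : injective prev_side.
Proof. exact: can_inj prev_sideK. Qed.

Lemma mem_prev_side s : (prev_side s \in sides T) = (s \in sides T).
Proof. by rewrite -(mem_next_side (prev_side s)) prev_sideK. Qed.

Lemma head_prev s : s \in sides T -> head (prev_side s) = tail s.
Proof. by move=> sT; rewrite -{2}(prev_sideK s) tail_next // mem_prev_side. Qed.

(** * Half-discs and the tile of a side *)

Lemma faces_inr a b x y : a != b -> faces_half a b (inr (x, y)) =
  [&& cwdist a x <= cwdist a b, cwdist a y <= cwdist a b
    & ~~ ((cwdist a x == 0) && (cwdist a y == cwdist a b))].
Proof.
move=> ab; rewrite /= cwdist_eq0 cwdist_eq !xpair_eqE.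
case: (altP (x =P b)) => [->|xb]; case: (altP (y =P a)) => [->|ya] /=.
- by rewrite leqnn cwdistxx /= eq_sym (negbTE ab).
all: case: (x == a); case: (y == b); 
  by rewrite //= ?(eq_sym b a) ?ab ?(negbTE ab) ?andbT ?andbF.
Qed.

(** No diagonal crosses {a, b}, so the position of the tail alone tells the half-disc, except at a
    and b, where the rank decides. *)
Lemma faces_tail a b t : joined a b -> t \in sides T ->
  faces_half a b t =
    if tail t == a then outrank t < cwdist a b
    else if tail t == b then cwdist b a <= outrank t
    else cwdist a (tail t) < cwdist a b.
Proof.
move=> jab; have ab := joined_neq jab; have := cwdist_joined jab => ab0.
case: t => [i|[x y]] tT.
  rewrite /=; case: eqP => [->|_]; first by rewrite cwdistxx.
  case: eqP => [->|//]; rewrite ltnn leqn0 cwdist_eq0.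
  by rewrite (negbTE ab).
rewrite sides_inr in tT; have xy := joined_neq tT; rewrite faces_inr //=.
case: (altP (x =P a)) => [xa|xa].
  by subst x; rewrite cwdistxx /= ltn_neqAle andbC.
case: (altP (x =P b)) => [xb|xb].
  subst x; rewrite leqnn cwdist_eq0 (negbTE xa) andbT /=.
  by move: ab xy; rewrite -!val_eqE /=; cwlia.
rewrite cwdist_eq0 (negbTE xa) andbT.
have ax : 0 < cwdist a x by rewrite lt0n cwdist_eq0.
have axb : cwdist a x != cwdist a b by rewrite cwdist_eq.
by move: (noncrossing jab tT) axb; rewrite ax /=; lia.
Qed.

(** The same test at the head. Strict and weak inequalities are exchanged because [inr (b, a)] faces
    this half-disc and [inr (a, b)] does not. *)
Lemma faces_head a b s : joined a b -> s \in sides T ->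
  faces_half a b s =
    if head s == a then inrank s <= cwdist a b
    else if head s == b then cwdist b a < inrank s
    else cwdist a (head s) < cwdist a b.
Proof.
move=> jab; have ab := joined_neq jab; have := cwdist_joined jab => ab0.
case: s => [i|[x y]] sT.
  rewrite /=; have := cwdist_ordS i n_ge2; move: (ordS i) => j.
  case: eqP => [->|]; [|case: eqP => [->|]].
  - by move: ab; rewrite -!val_eqE /=; cwlia.
  - by move: ab; rewrite -!val_eqE /=; cwlia.
  - by move=> /eqP + /eqP; rewrite -!val_eqE /=; cwlia.
rewrite sides_inr in sT; have xy := joined_neq sT; rewrite faces_inr //=.
case: (altP (y =P a)) => [ya|ya].
  subst y; rewrite cwdistxx /= [0 == _]eq_sym (cwdist_eq0 a b) (eq_sym b) (negbTE ab).
  by rewrite andbF andbT.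
case: (altP (y =P b)) => [yb|yb].
  subst y; rewrite leqnn cwdist_eq0 eqxx andbT /=.
  by move: ab xy; rewrite -!val_eqE /=; cwlia.
rewrite [cwdist a y == _]cwdist_eq (negbTE yb) andbF andbT.
have ay : 0 < cwdist a y by rewrite lt0n cwdist_eq0.
have ayb : cwdist a y != cwdist a b by rewrite cwdist_eq.
rewrite joinedC in sT.
by move: (noncrossing jab sT) ayb; rewrite ay /=; lia.
Qed.

(** Both sides are tested at the marked point where they meet, and there {a, b} has no rank strictly
    between theirs. *)
Lemma faces_next a b s : joined a b -> s \in sides T ->
  faces_half a b (next_side s) = faces_half a b s.
Proof.
move=> jab sT; rewrite faces_tail ?mem_next_side // faces_head // tail_next //.
have r := outrank_next sT; have := next_between sT.
case: eqP => [->|_]; first by move/(_ b jab); lia.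
case: eqP => [->|_] //; rewrite joinedC in jab.
by move/(_ a jab); lia.
Qed.

Lemma same_tile_next s : s \in sides T -> same_tile T s (next_side s).
Proof.
move=> sT; apply/forallP => a; apply/forallP => b; apply/implyP => jab.
by rewrite (faces_next jab).
Qed.

Lemma same_tileP s t :
  reflect (forall a b, joined a b -> faces_half a b s = faces_half a b t)
          (same_tile T s t).
Proof.
apply: (iffP forallP) => [h a b jab | h a].
  by move/forallP: (h a) => /(_ b)/implyP/(_ jab)/eqP.
by apply/forallP => b; apply/implyP => jab; rewrite (h a b).
Qed.

Lemma same_tile_refl s : same_tile T s s.
Proof. exact/same_tileP. Qed.

Lemma same_tile_sym s t : same_tile T s t = same_tile T t s.
Proof. by apply/same_tileP/same_tileP => h a b /h. Qed.

Lemma same_tile_trans : transitive (same_tile T).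
Proof.
by move=> t s u /same_tileP st /same_tileP tu; apply/same_tileP => a b j;
  rewrite st // tu.
Qed.

Definition tile_of s := [set t in sides T | same_tile T s t].

Lemma tilesP tau :
  reflect (exists2 s, s \in sides T & tau = tile_of s) (tau \in tiles T).
Proof. exact: imsetP. Qed.

Lemma tile_of_tiles s : s \in sides T -> tile_of s \in tiles T.
Proof. by move=> sT; apply/tilesP; exists s. Qed.

Lemma mem_tile_of s t : (t \in tile_of s) = (t \in sides T) && same_tile T s t.
Proof. by rewrite inE. Qed.

Lemma tile_of_eq s t : same_tile T s t -> tile_of s = tile_of t.
Proof.
move=> st; apply/setP => u; rewrite !mem_tile_of; case: (u \in sides T) => //=.
apply/idP/idP; last exact: same_tile_trans.
by apply: same_tile_trans; rewrite same_tile_sym.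
Qed.

Lemma tile_of_in tau s : tau \in tiles T -> s \in tau -> tau = tile_of s.
Proof.
by move=> /tilesP[t tT ->]; rewrite mem_tile_of => /andP[_ /tile_of_eq].
Qed.

(* The boundary segments that s cuts off from its tile. The arcs of the sides of
   a tile are disjoint, and following next_side they cover the whole boundary. *)
Definition arc s i := cwdist (tail s) i < cwdist (tail s) (head s).

(** The arc of a diagonal side lies on the far side of it from the tile. Hence the ends of t lie on
    the boundary complementary to the arc of s, and conversely. *)
Lemma same_tile_arc s t i : s \in sides T -> t \in sides T ->
  same_tile T s t -> arc s i -> arc t i -> s = t.
Proof.
move=> sT tT /same_tileP st; rewrite /arc.
case: s sT st => [j|[x y]] sT st; case: t tT st => [k|[z w]] tT st /=.
- by rewrite !cwdist_ordS // !ltnS !leqn0 !cwdist_eq0 => /eqP -> /eqP ->.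
- rewrite cwdist_ordS // ltnS leqn0 cwdist_eq0 => /eqP -> ji.
  rewrite sides_inr joinedC in tT; have := st w z tT.
  by rewrite /= eqxx; have := joined_neq tT; rewrite -val_eqE /=; cwlia.
- rewrite cwdist_ordS // ltnS leqn0 cwdist_eq0 => ji /eqP e.
  rewrite sides_inr joinedC in sT; have := st y x sT.
  by rewrite /= eqxx; have := joined_neq sT; rewrite -val_eqE /= -e; cwlia.
- case: (altP ((x, y) =P (z, w))) => [[-> ->] //|xyzw].
  rewrite sides_inr joinedC in sT; rewrite sides_inr joinedC in tT.
  have := st w z tT; have := st y x sT.
  have [xy zw] := (joined_neq sT, joined_neq tT).
  rewrite !faces_inr // !leqnn !cwdistxx !leq0n /= !cwdist_eq0.
  rewrite (eq_sym x) (negbTE xy) (eq_sym z w) (negbTE zw) /=.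
  move=> /esym/and3P[Z W _] /and3P[X Y _] ix iz.
  have Xi : cwdist y x <= cwdist y i.
    by move: xy ix {Z W X Y iz}; rewrite -val_eqE /=; cwlia.
  (* Clockwise from y, both z and w come no later than x. If z comes first, the arc of t stays
     before x and misses i. Otherwise y is on the way from z to w, which forces y = w and then z =
     x. *)
  case: (leqP (cwdist y z) (cwdist y w)) => ZW.
    by move: iz {X Y}; rewrite ltnNge; case/negP; move: Xi W ZW {ix Z}; cwlia.
  have yw : y = w.
    apply/eqP; rewrite -cwdist_eq0; move: Y ZW {ix iz X Z W Xi}; cwlia.
  subst w; have zx : z = x.
    by apply: (@cwdist_inj _ y); apply/eqP; rewrite eqn_leq Z X.
  by rewrite zx eqxx in xyzw.
Qed.

Lemma arc_tail s : s \in sides T -> arc s (tail s).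
Proof.
rewrite /arc cwdistxx; case: s => [i|[x y]] /=; first by rewrite cwdist_ordS.
by rewrite sides_inr; apply: cwdist_joined.
Qed.

Lemma cwdist_ordS_neq x i : ordS i != x -> cwdist x (ordS i) = (cwdist x i).+1.
Proof.
have := cwdist_ordS i n_ge2; move: (ordS i) => j; rewrite -val_eqE /=; cwlia.
Qed.

Lemma arc_ordS s i : arc s i -> arc s (ordS i) \/ ordS i = head s.
Proof.
rewrite /arc; case: (altP (ordS i =P tail s)) => [->|ix] l.
  by left; rewrite cwdistxx; apply: leq_ltn_trans l.
rewrite cwdist_ordS_neq // leq_eqVlt in l *.
case/orP: l => [/eqP e|]; last by left.
by right; apply: (@cwdist_inj _ (tail s)); rewrite cwdist_ordS_neq.
Qed.

(** Induction clockwise from the tail of [s0]: an arc containing a boundary segment contains the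
    next one or ends there, and then [next_side] takes over, unless the walk may leave [C] at this
    point, which [stop] records. *)
Lemma arcs_cover (C : {set side n}) (stop : pred 'I_n) s0 i :
  {subset C <= sides T} -> s0 \in C ->
  (forall s, s \in C -> stop (head s) || (next_side s \in C)) ->
  (exists2 s, s \in C & arc s i) \/
  (exists2 j, stop j & 0 < cwdist (tail s0) j <= cwdist (tail s0) i).
Proof.
move=> CT s0C Cn; have [m] := ubnP (cwdist (tail s0) i).
elim: m i => // m IH i; case: (altP (i =P tail s0)) => [-> _|ix].
  by left; exists s0; rewrite ?arc_tail ?CT.
have iE := ord_predK i; rewrite -iE in ix *; move: (ord_pred i) ix => j ix {i iE}.
rewrite cwdist_ordS_neq // ltnS => lm.
case: (IH j lm) => [[s sC sj]|[k sk /andP[k0 kj]]]; last first.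
  by right; exists k; rewrite // k0 ltnW.
case: (arc_ordS sj) => [sSj|e]; first by left; exists s.
case/orP: (Cn _ sC) => h; [right | left].
- by exists (head s); rewrite // -e cwdist_ordS_neq //=.
- by exists (next_side s) => //; rewrite e -tail_next ?arc_tail ?mem_next_side // CT.
Qed.

(** The arcs of [C] cover the whole boundary, and arcs of distinct sides of a tile are disjoint, so
    there is no room for a further side. In particular the walk around a tile meets all its
    sides. *)
Lemma tile_of_next_closed (C : {set side n}) s :
  s \in C -> C \subset tile_of s -> (forall t, t \in C -> next_side t \in C) ->
  C = tile_of s.
Proof.
move=> sC /subsetP Cs Cn; apply/eqP; rewrite eqEsubset; apply/andP; split.
  exact/subsetP.
apply/subsetP => u; rewrite mem_tile_of => /andP[uT su].
have CT : {subset C <= sides T}.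
  by move=> t /Cs; rewrite mem_tile_of => /andP[].
have Cn' t : t \in C -> pred0 (head t) || (next_side t \in C) by move=> /Cn ->.
have [[t tC tu]|[]//] := arcs_cover (tail u) CT sC Cn'.
rewrite same_tile_sym in su; have /Cs := tC; rewrite mem_tile_of => /andP[tT st].
by rewrite (same_tile_arc uT tT (same_tile_trans su st) (arc_tail uT) tu).
Qed.

(** * Occupied points and the extreme sides at a marked point *)

Definition occupied x := [exists y, joined x y].

Lemma occupied_joined x y : joined x y -> occupied x.
Proof. by move=> xy; apply/existsP; exists y. Qed.

(* If no diagonal ends at x, then last_out x and first_in x below are boundary
   segments. *)
Definition last_out x := next_side (inl (ord_pred x)).

Lemma last_out_sides x : last_out x \in sides T.
Proof. by rewrite mem_next_side sides_inl. Qed.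

Lemma tail_last_out x : tail (last_out x) = x.
Proof. by rewrite tail_next ?sides_inl //= ord_predK. Qed.

Lemma last_out_inl x : is_inl (last_out x) = ~~ occupied x.
Proof.
apply/idP/idP => [ix|nx].
  apply/negP => /existsP[y xy].
  have := @next_between (inl (ord_pred x)) y (sides_inl _).
  rewrite /= ord_predK => /(_ xy); rewrite -/(last_out x) cwdist_lt andbT.
  case: (last_out x) ix => //= i _.
  by rewrite (cwdist_joined xy).
have := last_out_sides x; have := tail_last_out x.
case: (last_out x) => [//|[z y]] /= -> xy; case/negP: nx.
by rewrite sides_inr in xy; apply: occupied_joined xy.
Qed.

Lemma last_out_free x : ~~ occupied x -> last_out x = inl x.
Proof.
rewrite -last_out_inl; have := tail_last_out x.
by case: (last_out x) => // i /= ->.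
Qed.

Lemma same_tile_last_out x : same_tile T (inl (ord_pred x)) (last_out x).
Proof. by rewrite same_tile_next ?sides_inl. Qed.

Definition first_in x := prev_side (inl x).

Lemma first_in_sides x : first_in x \in sides T.
Proof. by rewrite mem_prev_side sides_inl. Qed.

Lemma head_first_in x : head (first_in x) = x.
Proof. by rewrite head_prev ?sides_inl. Qed.

Lemma first_in_inl x : is_inl (first_in x) = ~~ occupied x.
Proof.
apply/idP/idP => ix.
  rewrite -last_out_inl /last_out.
  have := head_first_in x; have := prev_sideK (inl x).
  rewrite -/(first_in x); case: (first_in x) ix => // i _ ni /= xi.
  by rewrite -{1}xi ordSK ni.
have := next_sideK (inl (ord_pred x)); rewrite -/(last_out x) last_out_free //.
by rewrite /first_in => ->.
Qed.

Lemma first_in_inj : injective first_in.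
Proof. by move=> x y /prev_side_inj e; exact: inl_inj e. Qed.

End Sides.

Hypothesis connT : connected_quiver (tiling_quiver T).

(** * Open tiles and arrows *)

Section Angles.
Implicit Types (x y z a b c d w i j q : 'I_n) (s t u : side n).

Lemma joined_ex : exists x y, joined x y.
Proof.
case/andP: connT => /card_gt0P[[d dT] _] _.
case/andP: (tilT) => /forall_inP/(_ _ dT)/cards2P[x [y [_ e]]] _.
by exists x, y; rewrite /joined -e.
Qed.

(** Diagonals joined by an arrow share an endpoint. If no diagonal leaves [P], lying inside [P] is
    therefore constant along the connected quiver. *)
Lemma joined_mem (P : {set 'I_n}) :
  (forall x y, joined x y -> (x \in P) = (y \in P)) ->
  forall x z, occupied x -> occupied z -> x \in P -> z \in P.
Proof.
move=> jP x z /existsP[y xy] /existsP[w zw] xP.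
case/andP: connT => _ /forallP.
move/(_ (exist _ [set x; y] xy))/forallP/(_ (exist _ [set z; w] zw)) => c.
pose D := [pred v : vertex (tiling_quiver T) | val v \subset P].
have sub (p r : 'I_n) : joined p r -> ([set p; r] \subset P) = (p \in P).
  by move=> /jP e; rewrite subUset !sub1set -e andbb.
suff cD : closed (fun v w : vertex (tiling_quiver T) =>
    [exists a : arrow (tiling_quiver T),
       ((src a == v) && (tgt a == w)) || ((src a == w) && (tgt a == v))]) D.
  by move: (closed_connect cD c); rewrite !inE /= !sub // xP.
have srctgt (a : arrow (tiling_quiver T)) : (src a \in D) = (tgt a \in D).
  case: a => [[[d dT] [e eT]] /= de]; rewrite !inE /=.
  case/existsP: de => u /existsP[v /existsP[r /and4P[/eqP dE /eqP eE _ _]]].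
  by rewrite /= in dE eE; subst d e; rewrite !sub.
move=> u v /existsP[a /orP[]/andP[/eqP <- /eqP <-]] //.
Qed.

(** A diagonal from the boundary between the segments i and j to the other part would separate the
    two segments. *)
Lemma same_tile_inl_joined i j z w : same_tile T (inl i) (inl j) -> joined z w ->
  cwdist (ordS i) z <= cwdist (ordS i) j -> cwdist (ordS i) w <= cwdist (ordS i) j.
Proof.
move=> /same_tileP ij zw zij; rewrite leqNgt; apply/negP => wij.
have /= := ij z w zw; have := cwdist_ordS i n_ge2.
by move: (ordS i) zij wij => k; cwlia.
Qed.

Lemma same_tile_inl_occupied i j x z : same_tile T (inl i) (inl j) ->
  occupied x -> occupied z ->
  cwdist (ordS i) x <= cwdist (ordS i) j -> cwdist (ordS i) z <= cwdist (ordS i) j.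
Proof.
move=> ij ox oz xij.
have := @joined_mem [set z | cwdist (ordS i) z <= cwdist (ordS i) j] _ x z ox oz.
rewrite !inE; apply=> // u v uv; rewrite !inE; apply/idP/idP.
  exact: same_tile_inl_joined.
by apply: same_tile_inl_joined; rewrite // joinedC.
Qed.

(** One of the two parts between the segments runs from x clockwise to q. It contains the occupied
    point x, hence all occupied points; an occupied q is thus the one preceding x. *)
Lemma same_tile_pred_occupied x q z : same_tile T (inl (ord_pred x)) (inl q) ->
  occupied x -> occupied z -> cwdist x z <= cwdist x q.
Proof.
move=> xq ox oz; have := same_tile_inl_occupied xq ox oz.
by rewrite ord_predK; apply; rewrite cwdistxx.
Qed.

(** [C] is the walk from the segment before x to the segment at q. Its arcs cover the boundary from
    x to q, and beyond q there is no occupied point from which a missed diagonal could start. *)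
Lemma chain_tile x q (C : {set side n}) : occupied x ->
  same_tile T (inl (ord_pred x)) (inl q) -> last_out x \in C ->
  (forall s, s \in C -> [/\ s \in tile_of (inl (ord_pred x)), ~~ is_inl s
      & next_side s = inl q \/ next_side s \in C]) ->
  [set s in tile_of (inl (ord_pred x)) | ~~ is_inl s] = C.
Proof.
move=> ox xq hC CP; apply/setP => u; rewrite inE.
apply/idP/idP => [/andP[]|/CP[-> -> _]//].
have CT : {subset C <= sides T}.
  by move=> s /CP[+ _ _]; rewrite mem_tile_of => /andP[].
rewrite mem_tile_of => /andP[uT xu] iu.
have Cn s : s \in C -> pred1 q (head s) || (next_side s \in C).
  move=> sC; case: (CP _ sC) => _ _ [e|->]; last by rewrite orbT.
  by rewrite /= -tail_next ?CT // e /= eqxx.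
have [[s sC su]|[j /eqP ->]] := arcs_cover (tail u) CT hC Cn.
  rewrite same_tile_sym in xu; have [+ _ _] := CP _ sC.
  rewrite mem_tile_of => /andP[sT xs].
  by rewrite (same_tile_arc uT sT (same_tile_trans xu xs) (arc_tail uT) su).
rewrite tail_last_out => /andP[q0 qu].
case: u uT xu iu qu => [//|[p r]] /= uT xu _ qp.
rewrite sides_inr in uT.
have px := same_tile_pred_occupied xq ox (occupied_joined uT).
have pq : p = q by apply: (@cwdist_inj _ x); apply/eqP; rewrite eqn_leq px qp.
(* A side leaving q itself would end between x and q, with the segment before x on its far side. *)
subst p; rewrite joinedC in uT.
have rx := same_tile_pred_occupied xq ox (occupied_joined uT).
move/same_tileP: xu => /(_ _ _ uT); rewrite /= eqxx.
have := cwdist_ordS (ord_pred x) n_ge2; rewrite ord_predK.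
have := joined_neq uT; rewrite -val_eqE /=.
by move: (ord_pred x) q0 rx => y; clear; cwlia.
Qed.

(** Take for x the first occupied point after the segment: at an unoccupied point one boundary
    segment follows another in the same tile. *)
Lemma same_tile_last_out_ex i :
  exists2 x, occupied x & same_tile T (inl i) (inl (ord_pred x)).
Proof.
have [x0 [y0 /occupied_joined ox0]] := joined_ex.
case: (@arg_minnP _ x0 occupied (cwdist (ordS i)) ox0) => x ox xmin.
exists x => //; move: (leqnn (cwdist (ordS i) x)); move: {1 3}x.
move=> z; have [m] := ubnP (cwdist (ordS i) z).
elim: m z => // m IH z; case: (altP (z =P ordS i)) => [-> _ _|zi].
  by rewrite ordSK same_tile_refl.
have zE := ord_predK z; rewrite -zE in zi *; move: (ord_pred z) zi => j ji {z zE}.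
rewrite cwdist_ordS_neq // ltnS ordSK => jm jx.
apply: same_tile_trans (IH j jm (ltnW jx)) _.
have nj : ~~ occupied j by apply/negP => /xmin; lia.
by have := same_tile_last_out j; rewrite last_out_free.
Qed.

Lemma open_tilesE :
  open_tiles T = [set tile_of (inl (ord_pred x)) | x in occupied].
Proof.
apply/setP => tau; rewrite inE; apply/andP/imsetP => [[tauT]|[x ox ->]].
  rewrite negb_forall => /existsP[i]; rewrite negbK => itau.
  have [x ox ix] := same_tile_last_out_ex i; exists x => //.
  by rewrite -(tile_of_eq ix); apply: tile_of_in.
split; first by rewrite tile_of_tiles ?sides_inl.
rewrite negb_forall; apply/existsP; exists (ord_pred x).
by rewrite mem_tile_of sides_inl same_tile_refl.
Qed.

(** Seen from x, every occupied point comes no later than the start of the segment before y, but y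
    itself comes after that start unless y = x. *)
Lemma tile_of_pred_inj :
  {in occupied &, injective (fun x => tile_of (inl (ord_pred x)))}.
Proof.
move=> x y ox oy /setP/(_ (inl (ord_pred y))); rewrite !mem_tile_of.
rewrite sides_inl same_tile_refl /= => xy.
have := same_tile_pred_occupied xy ox oy.
have := cwdist_ordS (ord_pred y) n_ge2; rewrite ord_predK.
move: (ord_pred y) => z zy l; apply/eqP; rewrite -val_eqE /=.
by move: zy l; clear; cwlia.
Qed.

(** The empty set is a dummy value: diagonals of a tiling have two elements. *)
Definition diag s : diagonal n :=
  match s with inl i => set0 | inr (x, y) => [set x; y] end.
Definition rev_side s : side n :=
  match s with inl i => inl i | inr (x, y) => inr (y, x) end.

Lemma rev_sideK : involutive rev_side.
Proof. by case=> [i|[x y]]. Qed.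

Lemma diag_rev s : diag (rev_side s) = diag s.
Proof. by case: s => [i|[x y]] //=; rewrite setUC. Qed.

Lemma mem_rev_side s : (rev_side s \in sides T) = (s \in sides T).
Proof. by case: s => [i|[x y]] //; rewrite !sides_inr joinedC. Qed.

Lemma is_inl_rev s : is_inl (rev_side s) = is_inl s.
Proof. by case: s => [i|[x y]]. Qed.

Lemma set2_eq x y z w : x != y ->
  ([set x; y] == [set z; w]) = ((x, y) == (z, w)) || ((x, y) == (w, z)).
Proof.
move=> xy; rewrite !xpair_eqE; apply/eqP/idP => [e|].
  have := set22 x y; have := set21 x y; rewrite {}e !inE.
  by case/orP => /eqP xE; subst x; rewrite !(eq_sym y) (negbTE xy) ?orbF
    => /eqP <-; rewrite !eqxx ?orbT.
by case/orP => /andP[/eqP -> /eqP ->]; rewrite // setUC.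
Qed.

Lemma diag_inj s t : s \in sides T -> ~~ is_inl s -> ~~ is_inl t ->
  diag s = diag t -> s = t \/ s = rev_side t.
Proof.
case: s => [//|[x y]]; case: t => [//|[z w]]; rewrite sides_inr => xy _ _ /= /eqP.
rewrite set2_eq ?joined_neq //.
by case/orP => /eqP[-> ->]; [left | right].
Qed.

Lemma same_tile_rev s : s \in sides T -> ~~ is_inl s ->
  ~~ same_tile T s (rev_side s).
Proof.
case: s => [//|[x y]]; rewrite sides_inr => xy _; apply/negP => /same_tileP.
move/(_ x y xy); have := joined_neq xy.
by rewrite /= !xpair_eqE !eqxx => /negbTE ->.
Qed.

Lemma mem_tile_diag s t : (t \in [set t in tile_of s | ~~ is_inl t]) =
  [&& t \in sides T, same_tile T s t & ~~ is_inl t].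
Proof. by rewrite in_set mem_tile_of andbA. Qed.

(** The two faces of a diagonal lie in different tiles, so counting diagonals or diagonal sides is
    the same. *)
Lemma tile_lengthE s : s \in sides T ->
  tile_length T (tile_of s) = #|[set t in tile_of s | ~~ is_inl t]|.
Proof.
move=> sT; rewrite /tile_length -(@card_in_imset _ _ diag); last first.
  move=> t u; rewrite !mem_tile_diag => /and3P[tT st it] /and3P[uT su iu] e.
  case: (diag_inj tT it iu e) => // tu.
  have := same_tile_rev uT iu; rewrite -tu.
  rewrite same_tile_sym in su; by rewrite (same_tile_trans su st).
apply: eq_card => d; rewrite inE; apply/andP/imsetP => [[dT]|[t]].
  case/existsP => x /existsP[y /andP[/eqP dE ts]].
  by exists (inr (x, y)); rewrite // inE ts.
rewrite mem_tile_diag => /and3P[tT st it ->].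
case: t it st tT => [//|[x y]] _ st xyT; split; first by rewrite sides_inr in xyT.
by apply/existsP; exists x; apply/existsP; exists y; rewrite eqxx mem_tile_of xyT.
Qed.

Lemma next_side_neq_rev s : s \in sides T -> ~~ is_inl s -> next_side s != rev_side s.
Proof.
move=> sT is'; apply/eqP => e; have := outrank_next sT; rewrite e.
by case: s is' {sT e} => [//|[x y]] _ /=; rewrite ltnn.
Qed.

Lemma head_rev s : ~~ is_inl s -> head (rev_side s) = tail s.
Proof. by case: s => [//|[x y]]. Qed.

Lemma tail_rev s : ~~ is_inl s -> tail (rev_side s) = head s.
Proof. by case: s => [//|[x y]]. Qed.

Lemma rev_side_neq s : s \in sides T -> ~~ is_inl s -> s != rev_side s.
Proof.
case: s => [//|[x y]]; rewrite sides_inr => /joined_neq xy _; apply/eqP => -[e _].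
by rewrite e eqxx in xy.
Qed.

(** An arrow is only a pair of diagonals, and this makes it a single corner. Two distinct corners
    would need diagonals sharing both endpoints, so that a side would be followed by its own
    reverse. *)
Lemma diag_next_inj s t : s \in sides T -> t \in sides T ->
  ~~ is_inl s -> ~~ is_inl t -> ~~ is_inl (next_side s) -> ~~ is_inl (next_side t) ->
  diag s = diag t -> diag (next_side s) = diag (next_side t) -> s = t.
Proof.
move=> sT tT si ti nsi nti e en.
case: (diag_inj sT si ti e) => // es.
have nsT : next_side s \in sides T by rewrite mem_next_side.
case: (diag_inj nsT nsi nti en) => [/next_side_inj //|ens].
have ht : head (next_side t) = tail t.
  by rewrite -(tail_rev nti) -ens tail_next // es head_rev.
have := next_side_neq_rev tT ti; have := tail_next tT.
case: (next_side t) nti ht => [//|[x y]] _ /=.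
case: t ti tT {e en es ens} => [//|[z w]].
by move=> /= _ _ -> ->; rewrite eqxx.
Qed.

(** The half-discs of the two diagonals fix the directions of s and t, and a diagonal at x of
    intermediate rank would separate them. *)
Lemma adjacent_sides x y z s t : joined x y -> joined x z ->
  cwdist x y < cwdist x z -> s \in sides T -> t \in sides T ->
  same_tile T s t -> diag s = [set x; y] -> diag t = [set x; z] -> next_side t = s.
Proof.
move=> xy xz l sT tT /same_tileP st ds dt.
have is' : ~~ is_inl s.
  by case: s ds {sT st} => //= i /esym/setP/(_ x); rewrite !inE eqxx.
have it : ~~ is_inl t.
  by case: t dt {tT st} => //= i /esym/setP/(_ x); rewrite !inE eqxx.
have Fout (v w : 'I_n) : joined x w -> joined x v ->
    faces_half x w (inr (x, v)) = (cwdist x v < cwdist x w).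
  by move=> xw xu; rewrite faces_tail ?sides_inr //= eqxx.
have Fin (v w : 'I_n) : joined x w -> joined x v ->
    faces_half x w (inr (v, x)) = (cwdist x v <= cwdist x w).
  by move=> xw; rewrite joinedC => vx; rewrite faces_head ?sides_inr //= eqxx.
have tE : t = inr (z, x).
  case: (@diag_inj t (inr (x, z)) tT it isT dt) => // e; exfalso.
  have := st x z xz; rewrite e Fout // ltnn.
  case: (@diag_inj s (inr (x, y)) sT is' isT ds) => ->; first by rewrite Fout ?l.
  by rewrite Fin ?(ltnW l).
have sE : s = inr (x, y).
  case: (@diag_inj s (inr (x, y)) sT is' isT ds) => // e; exfalso.
  by have := st x y xy; rewrite tE e !Fin // leqnn leqNgt l.
apply: follows_eq => //; apply/and4P; split=> //; rewrite tE sE //=.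
apply/forall_inP => w xw; apply/negP => /andP[yw wz].
by have := st x w xw; rewrite tE sE Fout // Fin // yw leqNgt wz.
Qed.

(** * Arrows as corners of tiles *)

Implicit Types (e f : arrow (tiling_quiver T)) (v : vertex (tiling_quiver T)).

Lemma bounds_side (d : diagonal n) (tau : {set side n}) : bounds d tau ->
  exists2 s, s \in tau & diag s = d.
Proof.
move=> /existsP[x /existsP[y /andP[/eqP -> xy]]]; by exists (inr (x, y)).
Qed.

Lemma tiles_sub tau s : tau \in tiles T -> s \in tau -> s \in sides T.
Proof. by move=> /tilesP[t _ ->]; rewrite mem_tile_of => /andP[]. Qed.

Lemma tiles_same tau s t :
  tau \in tiles T -> s \in tau -> t \in tau -> same_tile T s t.
Proof.
move=> tauT sT; rewrite (tile_of_in tauT sT) mem_tile_of; by case/andP.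
Qed.

Lemma arrow_ends e : exists x y z, [/\ val (src e) = [set x; y],
  val (tgt e) = [set x; z], joined x y, joined x z & cwdist x y < cwdist x z].
Proof.
case: e => [[[d dT] [d' d'T]] /= /existsP[x /existsP[y /existsP[z]]]].
case/and4P=> /eqP /= dE /eqP /= d'E l _; exists x, y, z.
by split; rewrite // /joined -?dE -?d'E.
Qed.

Definition at_angle e s := [&& s \in sides T, ~~ is_inl s, ~~ is_inl (next_side s),
  diag s == val (tgt e) & diag (next_side s) == val (src e)].

Lemma at_angle_ex e : exists s, at_angle e s.
Proof.
case: e => [[[d dT] [d' d'T]] /= de]; rewrite /at_angle /=.
have := de; rewrite /is_tiling_arrow /=.
case/existsP => x /existsP[y /existsP[z /and4P[/eqP dE /eqP d'E l]]].
case/exists_inP => tau tauT /andP[/bounds_side[s ss sd]].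
move=> /bounds_side[t tt td]; exists t.
have [sT tT] := (tiles_sub tauT ss, tiles_sub tauT tt).
have nE : next_side t = s.
  apply: (@adjacent_sides x y z) => //; rewrite -?dE -?d'E //.
    by rewrite /joined -dE.
    by rewrite /joined -d'E.
  exact: tiles_same ss tt.
rewrite nE sd td !eqxx tT !andbT /=; apply/andP; split.
  by case: t td {tT tt nE} => //= i /esym/setP/(_ x); rewrite d'E !inE eqxx.
by case: s sd {sT ss nE} => //= i /esym/setP/(_ x); rewrite dE !inE eqxx.
Qed.

(* An arrow is an angle of a tile between two diagonals; we record the side
   [angle e] entering the corner. The other side [angle_out e] leaves it and is
   the next one clockwise around the tile, so that arrows go backwards. *)
Definition angle e : side n := xchoose (at_angle_ex e).
Definition angle_out e : side n := next_side (angle e).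

Lemma angleP e : [/\ angle e \in sides T, ~~ is_inl (angle e),
  ~~ is_inl (angle_out e), diag (angle e) = val (tgt e)
  & diag (angle_out e) = val (src e)].
Proof.
by have /and5P[aT ai no /eqP t /eqP s] := xchooseP (at_angle_ex e).
Qed.

Lemma angle_sides e : angle e \in sides T. Proof. by case: (angleP e). Qed.
Lemma angle_inr e : ~~ is_inl (angle e). Proof. by case: (angleP e). Qed.
Lemma angle_out_inr e : ~~ is_inl (angle_out e). Proof. by case: (angleP e). Qed.
Lemma diag_angle e : diag (angle e) = val (tgt e). Proof. by case: (angleP e). Qed.
Lemma diag_angle_out e : diag (angle_out e) = val (src e).
Proof. by case: (angleP e). Qed.

Lemma angle_out_sides e : angle_out e \in sides T.
Proof. by rewrite mem_next_side angle_sides. Qed.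

Lemma head_angle e : head (angle e) = tail (angle_out e).
Proof. by rewrite tail_next ?angle_sides. Qed.

Lemma angle_inj : injective angle.
Proof.
move=> e f ef; apply: val_inj; have := diag_angle e; have := diag_angle_out e.
rewrite /angle_out ef -/(angle_out f) diag_angle diag_angle_out.
move=> /val_inj /= e1 /val_inj /= e2.
by rewrite [LHS]surjective_pairing [RHS]surjective_pairing e1 e2.
Qed.

Lemma angle_out_inj : injective angle_out.
Proof. by move=> e f /next_side_inj/angle_inj. Qed.

Lemma angle_ex s : s \in sides T -> ~~ is_inl s -> ~~ is_inl (next_side s) ->
  exists e, angle e = s.
Proof.
move=> sT si ni; have nT : next_side s \in sides T by rewrite mem_next_side.
have inT u : u \in sides T -> ~~ is_inl u -> diag u \in T.
  by case: u => [//|[x y]]; rewrite sides_inr.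
have st := same_tile_next sT.
have de : is_tiling_arrow T (diag (next_side s)) (diag s).
  have := tail_next sT; have := outrank_next sT; move: st si ni sT nT.
  rewrite /is_tiling_arrow.
  case: s {inT} => [//|[z x]]; case: (next_side _) => [//|[x' y]] /= st _ _ sT nT l xE.
  subst x'; apply/existsP; exists x; apply/existsP; exists y; apply/existsP.
  exists z; apply/and4P; split=> //; first by rewrite setUC.
  apply/exists_inP; exists (tile_of (inr (z, x))); first exact: tile_of_tiles.
  apply/andP; split; apply/existsP.
  - exists x; apply/existsP; exists y.
    by rewrite eqxx mem_tile_of nT st.
  - by exists z; apply/existsP; exists x; rewrite eqxx mem_tile_of sT same_tile_refl.
pose e : arrow (tiling_quiver T) :=
  Sub (Sub (diag (next_side s)) (inT _ nT ni), Sub (diag s) (inT _ sT si)) de.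
exists e; apply: diag_next_inj; rewrite ?angle_sides ?angle_inr //.
- exact: angle_out_inr.
- by rewrite diag_angle.
- exact: diag_angle_out.
Qed.

Lemma angle_out_ex s : s \in sides T -> ~~ is_inl s -> ~~ is_inl (prev_side s) ->
  exists e, angle_out e = s.
Proof.
move=> sT si pi; have [e eE] : exists e, angle e = prev_side s.
  by apply: angle_ex; rewrite ?mem_prev_side ?prev_sideK.
by exists e; rewrite /angle_out eE prev_sideK.
Qed.

Lemma same_tile_angle e : same_tile T (angle e) (angle_out e).
Proof. by rewrite same_tile_next ?angle_sides. Qed.

Lemma angle_tgt e s : s \in sides T -> ~~ is_inl s ->
  (val (tgt e) == diag s) = (angle e == s) || (angle e == rev_side s).
Proof.
move=> sT si; rewrite -diag_angle; apply/eqP/orP => [h|[]/eqP ->//].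
  case: (diag_inj (angle_sides e) (angle_inr e) si h) => ->; rewrite eqxx; by [left|right].
exact: diag_rev.
Qed.

Lemma angle_src e s : s \in sides T -> ~~ is_inl s ->
  (val (src e) == diag s) = (angle_out e == s) || (angle_out e == rev_side s).
Proof.
move=> sT si; rewrite -diag_angle_out; apply/eqP/orP => [h|[]/eqP ->//].
  case: (diag_inj (angle_out_sides e) (angle_out_inr e) si h) => ->.
    by left.
  by right.
exact: diag_rev.
Qed.

(** Either both arrows use the same face of the common diagonal and follow one tile, or they use
    opposite faces and turn around the same marked point. *)
Lemma composable_angle e f : composable e f =
  (angle e == angle_out f) || (rev_side (angle e) == angle_out f).
Proof.
rewrite /composable -val_eqE -[val (src f)]diag_angle_out.
rewrite angle_tgt ?angle_out_sides ?angle_out_inr //.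
by rewrite -[angle e == rev_side _](inv_eq rev_sideK).
Qed.

Lemma relation_angle e f : composable e f ->
  [exists tau in tiles T, arrow_in_tile tau e && arrow_in_tile tau f] =
  (angle e == angle_out f).
Proof.
move=> ef; apply/exists_inP/eqP => [[tau tauT]|e_f]; last first.
  have b s t : s \in sides T -> ~~ is_inl s -> same_tile T t s ->
      bounds (diag s) (tile_of t).
    case: s => [//|[x y]] sT _ ts; apply/existsP; exists x; apply/existsP; exists y.
    by rewrite eqxx mem_tile_of sT.
  exists (tile_of (angle e)); first exact/tile_of_tiles/angle_sides.
  rewrite /arrow_in_tile -!diag_angle -!diag_angle_out.
  rewrite !b ?angle_sides ?angle_out_sides ?angle_inr ?angle_out_inr //=.
  - by rewrite e_f same_tile_sym same_tile_angle.
  - by rewrite e_f same_tile_refl.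
  - exact: same_tile_refl.
  - exact: same_tile_angle.
(* Sides of one tile lying on the two diagonals of an arrow are consecutive, hence form the corner
   of that arrow. *)
have inA (g : arrow (tiling_quiver T)) s t :
    s \in tau -> t \in tau -> diag s = val (src g) ->
    diag t = val (tgt g) -> t = angle g /\ s = angle_out g.
  move=> st tt ds dt.
  have [sT tT] := (tiles_sub tauT st, tiles_sub tauT tt).
  have nE : next_side t = s.
    have [x [y [z [dE d'E xy xz l]]]] := arrow_ends g.
    apply: (@adjacent_sides x y z); rewrite -?dE -?d'E //.
    exact: tiles_same st tt.
  have ni u (v : tiling_vertex T) : diag u = val v -> ~~ is_inl u.
    case: v => d dT; case: u => //= i dE.
    by case/andP: tilT => /forall_inP/(_ _ dT); rewrite -dE cards0.
  suff tE : t = angle g by rewrite /angle_out -tE nE.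
  apply: diag_next_inj; rewrite ?angle_sides ?angle_inr //.
  + exact: ni dt.
  + by rewrite nE; apply: ni ds.
  + exact: angle_out_inr.
  + by rewrite dt diag_angle.
  + by rewrite nE ds -diag_angle_out.
case/andP => /andP[/bounds_side[s1 s1t d1] /bounds_side[t1 t1t c1]].
move=> /andP[/bounds_side[s2 s2t d2] /bounds_side[t2 t2t c2]].
have [tE1 _] := inA _ _ _ s1t t1t d1 c1.
have [_ sE2] := inA _ _ _ s2t t2t d2 c2.
move: ef; rewrite composable_angle => /orP[/eqP //|/eqP e_f].
(* In the remaining case [tau] would contain both faces of the target of e. *)
have := same_tile_rev (angle_sides e) (angle_inr e).
by rewrite e_f -tE1 -sE2 (tiles_same tauT).
Qed.

End Angles.

(** * Permitted and forbidden threads *)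

Variable k : fieldType.
Local Notation A := (tiling_algebra T k).

Implicit Types (x y q : 'I_n) (s t : side n) (e f : arrow (tiling_quiver T)).
Implicit Types (v : vertex (tiling_quiver T)).
Implicit Types (a b c d : arrow A) (l : seq (arrow A)) (H F : thread A).

Lemma in_ideal_angle (e f : arrow A) : composable e f ->
  in_ideal e f = (angle e == angle_out f).
Proof.
move=> ef; apply/asboolP/idP => [I|e_f].
  apply: (@ideal_gen_relation k (tiling_quiver T)
            (fun e f => angle e == angle_out f) _ _ e f ef I).
  move=> x [a [b [ab tau ->]]]; exists a, b; split=> //.
  by rewrite -relation_angle.
apply: ideal_gen_in; exists e, f; split=> //.
by rewrite relation_angle.
Qed.

Lemma forbidden_stepE (e f : arrow A) :
  forbidden_step e f = (angle e == angle_out f).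
Proof.
apply/andP/idP => [[ef]|e_f]; first by rewrite in_ideal_angle.
have ef : composable e f by rewrite composable_angle e_f.
by rewrite in_ideal_angle.
Qed.

Lemma permitted_stepE (e f : arrow A) :
  permitted_step e f = (rev_side (angle e) == angle_out f).
Proof.
apply/andP/idP => [[ef]|e_f].
  rewrite in_ideal_angle //; move: ef; rewrite composable_angle.
  by case/orP => // ->.
have ef : composable e f by rewrite composable_angle e_f orbT.
rewrite in_ideal_angle // -(eqP e_f); split=> //.
exact: rev_side_neq (angle_sides e) (angle_inr e).
Qed.

Lemma permitted_step_functional (b c d : arrow A) :
  permitted_step b c -> permitted_step b d -> c = d.
Proof.
by rewrite !permitted_stepE => /eqP -> /eqP /angle_out_inj.
Qed.

(* Rotating clockwise around their common marked point, the successive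
   diagonals of a permitted path have increasing ranks. *)
Lemma permitted_path_uniq (s : seq (arrow A)) : permitted_path s -> uniq s.
Proof.
case: s => // a s ps.
apply: (@map_uniq _ _ (fun e : arrow A => inrank (angle e))).
apply: (sorted_uniq ltn_trans ltnn); move: ps => /=.
elim: s a => //= b s IH a /andP[ab /IH ->]; rewrite andbT.
move: ab; rewrite permitted_stepE => /eqP ab.
have := outrank_next (angle_sides b); rewrite -/(angle_out b) -ab.
by have := angle_inr a; case: (angle a) => [//|[x y]].
Qed.

Lemma permitted_path_size (s : seq (arrow A)) :
  permitted_path s -> size s <= #|arrow A|.
Proof. by move=> /permitted_path_uniq/card_uniqP <-; apply: max_card. Qed.

Lemma forbidden_path_size (s : seq (arrow A)) :
  forbidden_path s -> size s <= #|arrow A|.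
Proof.
have us : forbidden_path s -> uniq s by case: s => // a s /andP[].
by move=> /us/card_uniqP <-; apply: max_card.
Qed.

Lemma maximal_pathP (P : pred (seq (arrow A))) l :
  maximal_path P l ->
  [/\ P l, forall c, ~~ P (c :: l) & forall c, ~~ P (rcons l c)].
Proof.
by case/andP=> Ps /forallP m; split=> // c; case/andP: (m c).
Qed.

Lemma is_thread_cons P (R : rel (arrow A)) H a l :
  is_thread P R H -> thread_arrows H = a :: l ->
  [/\ maximal_path P (a :: l), thread_src H = src a,
      thread_tgt H = tgt (last a l) & thread_sign H = false].
Proof.
rewrite /is_thread /thread_tgt => + e; rewrite e => /and3P[/andP[/eqP sE _] m /negbTE ->].
by split=> //; exact: (last_map (@tgt A)).
Qed.

Lemma is_threadI P (R : rel (arrow A)) a l (h : size (a :: l) <= #|arrow A|) :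
  path (@composable A) a l -> maximal_path P (a :: l) ->
  is_thread P R ((src a, Bseq h, false) : thread A).
Proof. by move=> c m; apply/and3P; split=> //; apply/andP; split. Qed.

Lemma first_arrow_cons H a l :
  thread_arrows H = a :: l -> first_arrow H = Some a.
Proof. by rewrite /first_arrow => ->. Qed.

Lemma final_arrow_cons H a l :
  thread_arrows H = a :: l -> final_arrow H = Some (last a l).
Proof. by rewrite /final_arrow => ->; rewrite lastI rev_rcons. Qed.

Lemma permitted_thread_ex (a : arrow A) : (forall c, ~~ permitted_step c a) ->
  exists H : thread A, permitted_thread H && (first_arrow H == Some a).
Proof.
move=> na; have [s [Ps ms]] :=
  max_extension permitted_path_size (isT : permitted_path [:: a]).
exists (src a, Bseq (permitted_path_size Ps), false).
rewrite (@first_arrow_cons _ a s) // eqxx andbT; apply: is_threadI.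
  by apply: sub_path Ps => b c /andP[].
apply/andP; split=> //; apply/forallP => c; rewrite ms andbT /=.
by rewrite (negbTE (na c)).
Qed.

Lemma forbidden_thread_ex (b : arrow A) : (forall c, ~~ forbidden_step b c) ->
  exists F : thread A, forbidden_thread F && (final_arrow F == Some b).
Proof.
(* Reversal, since the path has to be prolonged at its start. *)
move=> nb; pose P (s : seq (arrow A)) := forbidden_path (rev s).
have sP l : P l -> size l <= #|arrow A|.
  by move/forbidden_path_size; rewrite size_rev.
have [s [Ps ms]] := max_extension sP (isT : P [:: b]).
case E : (rev (b :: s)) => [|a t]; first by move: (size_rev (b :: s)); rewrite E.
have bE : last a t = b by rewrite -(last_cons b a t) -E rev_cons last_rcons.
rewrite /P E in Ps; have /andP[pt ut] := Ps.
exists (src a, Bseq (forbidden_path_size Ps), false).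
rewrite (@final_arrow_cons _ a t) // bE eqxx andbT; apply: is_threadI.
  by apply: sub_path pt => c d /andP[].
apply/andP; split=> //; apply/forallP => c; apply/andP; split.
  by have := ms c; rewrite /P rev_rcons E.
by rewrite /= rcons_path bE (negbTE (nb c)) andbF.
Qed.

Lemma first_inE s : s \in sides T -> is_inl (next_side s) -> first_in (head s) = s.
Proof.
move=> sT i; rewrite -[RHS]next_sideK /first_in; congr prev_side.
by have := tail_next sT; case: (next_side s) i => // j _ <-.
Qed.

Lemma last_outE s : s \in sides T -> is_inl (prev_side s) -> last_out (tail s) = s.
Proof.
move=> sT i; rewrite -[RHS]prev_sideK /last_out; congr next_side.
by have := head_prev sT; case: (prev_side s) i => // j _ <- /=; rewrite ordSK.
Qed.

Lemma next_first_in x : next_side (first_in x) = inl x.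
Proof. exact: prev_sideK. Qed.

Lemma prev_last_out x : prev_side (last_out x) = inl (ord_pred x).
Proof. exact: next_sideK. Qed.

Lemma angle_first_in e x : angle e != first_in x.
Proof.
apply/eqP => h; have := angle_out_inr e.
by rewrite /angle_out h next_first_in.
Qed.

Lemma angle_out_last_out e x : angle_out e != last_out x.
Proof.
apply/eqP => h; have := angle_inr e.
by rewrite -(next_sideK (angle e)) -/(angle_out e) h prev_last_out.
Qed.

(** * Trivial permitted threads and lone ends of diagonals *)

Lemma vertex_side v : exists2 s, s \in sides T & diag s = val v /\ ~~ is_inl s.
Proof.
case/andP: (tilT) => /forall_inP/(_ _ (valP v))/cards2P[x [y [_ e]]] _.
exists (inr (x, y)); last by rewrite e.
by rewrite sides_inr /joined -e; apply: valP.
Qed.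

(* No other diagonal than s ends at the head of s. *)
Definition lone s := is_inl (next_side s) && is_inl (prev_side (rev_side s)).

Lemma lone_angle s e : lone s -> angle e != s.
Proof.
case/andP=> i _; apply: contraL i => /eqP <-.
exact: angle_out_inr.
Qed.

Lemma lone_angle_out s e : lone s -> angle_out e != rev_side s.
Proof.
case/andP=> _; apply: contraL => /eqP <-.
by rewrite /angle_out next_sideK; apply: angle_inr.
Qed.

Lemma mem_arrows_into (v : vertex A) s e : s \in sides T -> ~~ is_inl s ->
  diag s = val v -> (e \in arrows_into v) = (angle e == s) || (angle e == rev_side s).
Proof. by move=> sT si sv; rewrite inE -val_eqE -angle_tgt // sv. Qed.

Lemma mem_arrows_from (v : vertex A) s e : s \in sides T -> ~~ is_inl s ->
  diag s = val v ->
  (e \in arrows_from v) = (angle_out e == s) || (angle_out e == rev_side s).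
Proof. by move=> sT si sv; rewrite inE -val_eqE -angle_src // sv. Qed.

Lemma not_lone s : s \in sides T -> ~~ is_inl s -> ~~ lone s ->
  (exists e, angle e = s) \/ (exists e, angle_out e = rev_side s).
Proof.
move=> sT si; rewrite negb_and => /orP[i|i]; [left | right].
  exact: angle_ex.
by apply: angle_out_ex; rewrite ?mem_rev_side ?is_inl_rev.
Qed.

Lemma trivial_signs_neq0 (R : rel (arrow A)) (v : vertex A) (b : bool) :
  valency v != 0 -> trivial_signs R v b -> b = false.
Proof. by rewrite /trivial_signs => /negbTE -> /andP[_ /negbTE]. Qed.

(** If neither end were lone, there would be an arrow at each. Two arrows into v, or two out of it,
    exclude a trivial thread; one in and one out at different ends use the same face of v, so their
    composition is a relation. *)
Lemma trivial_lone (v : vertex A) (b : bool) s : s \in sides T -> ~~ is_inl s ->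
  diag s = val v -> trivial_signs (@permitted_step k A) v b ->
  lone s \/ lone (rev_side s).
Proof.
move=> sT si sv tr.
case: (boolP (lone s)) => [|ns]; [by left | right].
apply/negPn/negP => nr.
have rT : rev_side s \in sides T by rewrite mem_rev_side.
have ri : ~~ is_inl (rev_side s) by rewrite is_inl_rev.
have inE1 := mem_arrows_into _ sT si sv; have outE1 := mem_arrows_from _ sT si sv.
have sr := rev_side_neq sT si.
have := not_lone rT ri nr; have := not_lone sT si ns; rewrite rev_sideK.
have I e : e \in arrows_into v -> 0 < #|arrows_into v|.
  by move=> h; apply/card_gt0P; exists e.
have O e : e \in arrows_from v -> 0 < #|arrows_from v|.
  by move=> h; apply/card_gt0P; exists e.
have tr' : 1 < valency v -> exists a b', [/\ arrows_into v = [set a],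
    arrows_from v = [set b'] & permitted_step a b'].
  move: tr; rewrite /trivial_signs; case: (valency v) => [|[|m]] //= /andP[+ _] _.
  by case/existsP=> a /existsP[b' /and3P[/eqP ? /eqP ? ?]]; exists a, b'.
case=> [[e es]|[e es]] [[f fr]|[f fr]].
- have ef : e != f by apply: contraNneq sr => h; rewrite -fr -es h.
  have c : 1 < #|arrows_into v|.
    by apply/card_gt1P; exists e, f; rewrite !inE1 es fr !eqxx ?orbT.
  have [a [a' [h _ _]]] := tr' (leq_trans c (leq_addr _ _)).
  by move: c; rewrite h cards1.
- have := I e; have := O f; rewrite inE1 outE1 es fr !eqxx /= => /(_ isT) c' /(_ isT) c.
  have [a [a' [ha ha' st]]] := tr' (leq_add c c').
  have := inE1 e; rewrite ha inE es eqxx => /eqP ea.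
  have := outE1 f; rewrite ha' inE fr eqxx => /eqP fa.
  by move: st; rewrite permitted_stepE -ea -fa es fr eq_sym (negbTE sr).
- have := I f; have := O e; rewrite inE1 outE1 es fr !eqxx !orbT /=.
  move=> /(_ isT) c' /(_ isT) c.
  have [a [a' [ha ha' st]]] := tr' (leq_add c c').
  have := inE1 f; rewrite ha inE fr eqxx orbT => /eqP fa.
  have := outE1 e; rewrite ha' inE es eqxx orbT => /eqP ea.
  by move: st; rewrite permitted_stepE -ea -fa es fr rev_sideK (negbTE sr).
- have ef : e != f by apply: contraNneq sr => h; rewrite -es -fr h.
  have c : 1 < #|arrows_from v|.
    by apply/card_gt1P; exists e, f; rewrite !outE1 es fr !eqxx ?orbT.
  have [a [a' [_ h _]]] := tr' (leq_trans c (leq_addl _ _)).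
  by move: c; rewrite h cards1.
Qed.

Lemma valency0_lone (v : vertex A) s : s \in sides T -> ~~ is_inl s ->
  diag s = val v -> valency v = 0 -> lone s.
Proof.
move=> sT si sv v0; apply/negPn/negP => /not_lone[]// -[e es].
  have := valency0_into e v0.
  by rewrite (mem_arrows_into _ sT si sv) es eqxx.
have := valency0_from e v0.
by rewrite (mem_arrows_from _ sT si sv) es eqxx orbT.
Qed.

(** All arrows at v turn around the tail of s: at most one arrives, at most one leaves, and their
    composition is not a relation. *)
Lemma lone_trivial (v : vertex A) (b : bool) s : s \in sides T -> ~~ is_inl s ->
  diag s = val v -> lone s -> (b -> valency v = 0) ->
  trivial_signs (@permitted_step k A) v b.
Proof.
move=> sT si sv ls bv; rewrite /trivial_signs.
have inE1 := mem_arrows_into _ sT si sv; have outE1 := mem_arrows_from _ sT si sv.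
have I e : e \in arrows_into v -> angle e = rev_side s.
  by rewrite inE1 (negbTE (lone_angle _ ls)) => /eqP.
have O e : e \in arrows_from v -> angle_out e = s.
  by rewrite outE1 (negbTE (lone_angle_out _ ls)) orbF => /eqP.
have cI : #|arrows_into v| <= 1.
  by apply/card_le1_eqP => e f /I h /I h'; apply: angle_inj; rewrite h h'.
have cO : #|arrows_from v| <= 1.
  by apply/card_le1_eqP => e f /O h /O h'; apply: angle_out_inj; rewrite h h'.
have ar m p : m <= 1 -> p <= 1 -> m + p = 0 \/ m + p = 1 \/ m = 1 /\ p = 1.
  by clear; lia.
case: (eqVneq (valency v) 0) => [//|v0].
have -> : b = false by apply/negP => /bv/eqP; apply/negP.
apply/orP; right; rewrite andbT.
case: (ar _ _ cI cO) => [vv|[vv|[i1 o1]]].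
- by case/eqP: v0.
- by apply/orP; left; apply/eqP.
apply/orP; right; have /cards1P[a aE] : #|arrows_into v| == 1 by rewrite i1.
have /cards1P[c cE] : #|arrows_from v| == 1 by rewrite o1.
apply/existsP; exists a; apply/existsP; exists c; rewrite aE cE !eqxx /=.
by rewrite permitted_stepE (I a) ?(O c) ?aE ?cE ?inE // rev_sideK.
Qed.

(* Distinguishes the two trivial threads at a vertex of valency zero. *)
Definition end_sign (v : vertex A) x :=
  (valency v == 0) && [exists y in (val (v : tiling_vertex T)), y < x].

(* H is the rotation around the marked point x; it is trivial when a single
   diagonal ends at x. *)
Record based_at x (H : thread A) : Prop := BasedAt {
  based_permitted : permitted_thread H;
  based_occupied : occupied x;
  based_src : val (thread_src H : tiling_vertex T) = diag (first_in x);
  based_tgt : val (thread_tgt H : tiling_vertex T) = diag (last_out x);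
  based_first : forall b,
    (first_arrow H == Some b) = (angle_out b == rev_side (first_in x));
  based_final : forall b,
    (final_arrow H == Some b) = (angle b == rev_side (last_out x));
  based_sign : thread_sign H = end_sign (thread_src H) x }.

Lemma based_trivial (v : vertex A) s : s \in sides T -> ~~ is_inl s ->
  diag s = val v -> lone s ->
  based_at (head s) (trivial_thread v (end_sign v (head s))).
Proof.
move=> sT si sv ls; have /andP[ns pr] := ls.
have fE := first_inE sT ns.
have lE : last_out (head s) = rev_side s.
  by rewrite -tail_rev //; apply: last_outE; rewrite ?mem_rev_side.
split=> //.
- by apply: (lone_trivial sT si sv ls) => /andP[/eqP].
- by have := first_in_inl (head s); rewrite fE (negbTE si) => /esym/negbFE.
- by rewrite fE sv.
- by rewrite lE diag_rev sv.
- by move=> b; rewrite fE (negbTE (lone_angle_out _ ls)).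
- by move=> b; rewrite lE rev_sideK (negbTE (lone_angle _ ls)).
Qed.

Lemma end_sign_head (v : vertex A) s : s \in sides T -> ~~ is_inl s ->
  diag s = val v ->
  end_sign v (head s) = (valency v == 0) && (tail s < head s).
Proof.
case: s => [//|[x y]]; rewrite sides_inr => /joined_neq xy _ sv.
rewrite /end_sign -sv; congr andb => /=; apply/exists_inP/idP => [[z]|xy'].
  by rewrite !inE => /orP[]/eqP -> //; rewrite ltnn.
by exists x; rewrite ?set21.
Qed.

(** A trivial thread is based at a lone end of its diagonal, a non-trivial one at the point around
    which all its arrows turn. *)
Lemma based_ex (H : thread A) : permitted_thread H -> exists x, based_at x H.
Proof.
move=> pH; case E : (thread_arrows H) => [|a s].
  case: H pH E => [[v [u hu]] b] /= + uE; rewrite /thread_arrows /= in uE; subst u.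
  have -> : Bseq hu = [bseq] :> #|arrow A|.-bseq (arrow A) by apply: val_inj.
  rewrite /permitted_thread /is_thread /= => tr.
  have [s sT [sv si]] := vertex_side v.
  have rT : rev_side s \in sides T by rewrite mem_rev_side.
  have ri : ~~ is_inl (rev_side s) by rewrite is_inl_rev.
  have rv : diag (rev_side s) = val v by rewrite diag_rev.
  (* At valency zero both ends are lone; sign [true] belongs to the end with the larger number. *)
  case: (eqVneq (valency v) 0) => [v0|v0].
    have B := based_trivial sT si sv (valency0_lone sT si sv v0).
    have B' := based_trivial rT ri rv (valency0_lone rT ri rv v0).
    have := end_sign_head rT ri rv; have := end_sign_head sT si sv.
    rewrite v0 /= tail_rev // head_rev // => e1 e2.
    have st : (tail s : nat) != head s.
      case: (s) sT si => [//|[x y]]; rewrite sides_inr => /joined_neq.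
      by rewrite -val_eqE.
    case: (eqVneq b (tail s < head s)) => bE.
      by exists (head s); rewrite bE -e1.
    exists (tail s); move: B'; rewrite head_rev // e2 /=.
    suff -> : b = (head s < tail s) by [].
    rewrite ltnNge leq_eqVlt (negbTE st) /=.
    by move: bE; case: (b); case: (tail s < head s).
  have [e0 e0'] : end_sign v (head s) = false /\ end_sign v (head (rev_side s)) = false.
    by rewrite /end_sign (negbTE v0).
  have bE := trivial_signs_neq0 v0 tr.
  case: (trivial_lone sT si sv tr) => l.
    by exists (head s); rewrite bE -e0; apply: based_trivial.
  by exists (head (rev_side s)); rewrite bE -e0'; apply: based_trivial.
have [/maximal_pathP[Ps ml mr] sE tE gE] := is_thread_cons pH E.
have aT := angle_out_sides a; have ai := angle_out_inr a.
set b := last a s in tE; have bT := angle_sides b; have bi := angle_inr b.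
pose x := head (angle a).
have bx : head (angle b) = x.
  apply/eqP; apply: (@path_closed _ _ (fun c => head (angle c) == x) a s _ Ps).
  - move=> c d; rewrite permitted_stepE => /eqP cd /eqP <-.
    by rewrite head_angle -cd tail_rev // angle_inr.
  - exact: eqxx.
  - exact: mem_last.
(* Otherwise the rotation around x could be prolonged at its start; likewise at its end for
   [last_out x]. *)
have fE : first_in x = rev_side (angle_out a).
  rewrite /x head_angle -head_rev //; apply: first_inE; rewrite ?mem_rev_side //.
  apply/negPn/negP => i; have [||//|c cE] := @angle_ex (rev_side (angle_out a)).
    by rewrite mem_rev_side.
    by rewrite is_inl_rev.
  by have := ml c; rewrite /= permitted_stepE cE rev_sideK eqxx (Ps : path _ a s).
have lE : last_out x = rev_side (angle b).
  rewrite -bx -tail_rev //; apply: last_outE; rewrite ?mem_rev_side //.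
  apply/negPn/negP => i; have [||//|c cE] := @angle_out_ex (rev_side (angle b)).
    by rewrite mem_rev_side.
    by rewrite is_inl_rev.
  by have := mr c; rewrite /= rcons_path permitted_stepE -/b cE eqxx andbT (Ps : path _ a s).
exists x; split=> //.
- by have := first_in_inl x; rewrite fE is_inl_rev (negbTE ai) => /esym/negbFE.
- by rewrite sE fE diag_rev diag_angle_out.
- by rewrite tE lE diag_rev diag_angle.
- move=> c; rewrite (first_arrow_cons E) fE rev_sideK.
  by rewrite (inj_eq angle_out_inj) eq_sym; apply/eqP/eqP => [[]|->].
- move=> c; rewrite (final_arrow_cons E) lE rev_sideK.
  by rewrite (inj_eq angle_inj) eq_sym; apply/eqP/eqP => [[]|->].
- rewrite gE /end_sign sE; case: eqP => // v0; exfalso.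
  by have := valency0_from a v0; rewrite inE eqxx.
Qed.

Lemma thread_eq H H' : thread_src H = thread_src H' ->
  thread_arrows H = thread_arrows H' -> thread_sign H = thread_sign H' -> H = H'.
Proof.
case: H => [[v l] b]; case: H' => [[v' l'] b'].
by rewrite /thread_src /thread_arrows /thread_sign /= => -> /val_inj -> ->.
Qed.

Lemma based_uniq x H H' : based_at x H -> based_at x H' -> H = H'.
Proof.
move=> B B'; have vE : thread_src H = thread_src H'.
  by apply: val_inj; rewrite [LHS](based_src B) [RHS](based_src B').
apply: thread_eq; rewrite ?(based_sign B) ?(based_sign B') ?vE //.
have fE b : (first_arrow H == Some b) = (first_arrow H' == Some b).
  by rewrite (based_first B) (based_first B').
case E : (thread_arrows H) => [|a l]; case E' : (thread_arrows H') => [|a' l'] //.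
- by have := fE a'; rewrite (first_arrow_cons E') eqxx /first_arrow E.
- by have := fE a; rewrite (first_arrow_cons E) eqxx /first_arrow E'.
have := fE a'; rewrite (first_arrow_cons E) (first_arrow_cons E') eqxx => /eqP[aE].
subst a'; congr cons.
have [/maximal_pathP[P _ m] _ _ _] := is_thread_cons (based_permitted B) E.
have [/maximal_pathP[P' _ m'] _ _ _] := is_thread_cons (based_permitted B') E'.
exact: (maximal_path_uniq permitted_step_functional _ P P' m m').
Qed.

Lemma first_in_inr x : occupied x -> ~~ is_inl (first_in x).
Proof. by rewrite first_in_inl negbK. Qed.

Lemma last_out_inr x : occupied x -> ~~ is_inl (last_out x).
Proof. by rewrite last_out_inl negbK. Qed.

Lemma lone_first_in x : occupied x ->
  (forall e, angle_out e != rev_side (first_in x)) -> lone (first_in x).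
Proof.
move=> ox no; rewrite /lone next_first_in /=; apply/negPn/negP => i.
have [e eE] : exists e, angle_out e = rev_side (first_in x).
  by apply: angle_out_ex; rewrite ?mem_rev_side ?first_in_sides ?is_inl_rev ?first_in_inr.
by have := no e; rewrite eE eqxx.
Qed.

Lemma based_at_ex x : occupied x -> exists H, based_at x H.
Proof.
move=> ox; have xi := first_in_inr ox; have xT := first_in_sides x.
case: (pickP (fun a : arrow A => angle_out a == rev_side (first_in x))) => [a /eqP ax|no].
  have na c : ~~ permitted_step c a.
    by rewrite permitted_stepE ax (inv_eq rev_sideK) rev_sideK angle_first_in.
  have [H /andP[pH /eqP fH]] := permitted_thread_ex na.
  have [y B] := based_ex pH; exists H.
  have := based_first B a; rewrite fH eqxx ax => /esym/eqP/(can_inj rev_sideK).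
  by move/first_in_inj => ->.
have l : lone (first_in x) by apply: lone_first_in => // e; rewrite no.
have vT : diag (first_in x) \in T.
  by case: (first_in x) xi xT => [//|[y z]]; rewrite sides_inr.
pose v : vertex A := (Sub (diag (first_in x)) vT : tiling_vertex T).
have := @based_trivial v _ xT xi erefl l; rewrite head_first_in.
by exists (trivial_thread v (end_sign v x)).
Qed.

(** A first arrow determines the base point. Without arrows, two base points would be lone ends of
    the same diagonal, whose valency is then zero, and the sign tells them apart. *)
Lemma based_inj x y H : based_at x H -> based_at y H -> x = y.
Proof.
move=> B B'; have ox := based_occupied B; have oy := based_occupied B'.
have xT := first_in_sides x; have yT := first_in_sides y.
have xi := first_in_inr ox; have yi := first_in_inr oy.
have sv := based_src B; have sv' := based_src B'.
have [|yx] := diag_inj xT xi yi (etrans (esym sv) sv'); first exact: first_in_inj.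
case E : (thread_arrows H) => [|a l]; last first.
  have := based_first B a; have := based_first B' a.
  rewrite (first_arrow_cons E) eqxx => /esym/eqP -> /esym/eqP.
  by move/(can_inj rev_sideK)/first_in_inj.
have no z : based_at z H -> forall e, angle_out e != rev_side (first_in z).
  by move=> Bz e; rewrite -(based_first Bz e) /first_arrow E.
have lx := lone_first_in ox (no _ B); have ly := lone_first_in oy (no _ B').
have v0 : valency (thread_src H) = 0.
  apply: valency0I => e.
  - rewrite (mem_arrows_into _ xT xi (esym sv)) negb_or lone_angle //=.
    by rewrite yx rev_sideK lone_angle.
  - rewrite (mem_arrows_from _ xT xi (esym sv)) negb_or (no _ B) andbT.
    by rewrite yx (no _ B').
have := based_sign B; rewrite (based_sign B').
have := end_sign_head xT xi (esym sv); have := end_sign_head yT yi (esym sv').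
rewrite !head_first_in v0 /= => -> ->.
have ->: tail (first_in x) = y by rewrite yx tail_rev ?head_first_in.
have ->: tail (first_in y) = x by rewrite -head_rev // -yx head_first_in.
by move=> h; apply: val_inj => /=; move: h; case: ltngtP.
Qed.

(** * One step of the algorithm *)

Lemma mem_tile_last_out x u : u \in sides T -> same_tile T (last_out x) u ->
  u \in tile_of (inl (ord_pred x)).
Proof.
move=> uT xu; rewrite mem_tile_of uT; apply: same_tile_trans xu.
exact: same_tile_last_out.
Qed.

(** The path runs backwards along the walk starting at [last_out x], and maximality at its start
    makes this walk reach a boundary segment, the one at q. The [(size l).+1] arrows join one more
    diagonal than their number. *)
Lemma forbidden_path_tile x a l : occupied x ->
  maximal_path (@forbidden_path k A) (a :: l) ->
  angle (last a l) = last_out x ->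
  exists q, [/\ first_in q = angle_out a, same_tile T (inl (ord_pred x)) (inl q)
    & tile_length T (tile_of (inl (ord_pred x))) = (size l).+2].
Proof.
move=> ox /maximal_pathP[/andP[pl ul] ml _] lE; set b := last a l in lE.
have same c : c \in a :: l -> same_tile T (angle_out a) (angle c).
  move: c; apply: (@path_closed _ _ (fun c => same_tile T (angle_out a) (angle c))
    a l _ pl); last by rewrite same_tile_sym same_tile_angle.
  move=> d d'; rewrite forbidden_stepE => /eqP dd' ad; apply: same_tile_trans ad _.
  by rewrite dd' same_tile_sym same_tile_angle.
(* If the path closed up, a would recur, or [last_out x] would be the outgoing side of an arrow
   although it comes after a boundary segment. *)
have neq c : c \in a :: l -> angle c != angle_out a.
  move=> cl; apply/eqP => ca; case: (path_next pl cl) => [cb|[d dl]].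
    by have := angle_out_last_out a x; rewrite -ca cb lE eqxx.
  rewrite forbidden_stepE ca => /eqP/angle_out_inj ad; subst d.
  by move: ul; rewrite /= dl.
have gT := angle_out_sides a; have gi := angle_out_inr a.
(* An arrow at this corner would prolong the path; by [neq] it is a new one, so distinctness of the
   arrows is kept. *)
have ng : is_inl (next_side (angle_out a)).
  apply/negPn/negP => i; have [c cE] := angle_ex gT gi i.
  have cl : c \notin a :: l by apply/negP => /neq; rewrite cE eqxx.
  have := ml c; rewrite /forbidden_path cons_uniq cl ul andbT.
  by rewrite [path _ c _]/= forbidden_stepE cE eqxx pl.
have fE := first_inE gT ng; set q := head _ in fE.
have bl : b \in a :: l by apply: mem_last.
have xg : same_tile T (last_out x) (angle_out a).
  by rewrite -lE same_tile_sym same.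
exists q; split=> //.
  apply: same_tile_trans (same_tile_last_out x) _; apply: same_tile_trans xg _.
  by rewrite -(next_first_in q) fE same_tile_next.
pose L := angle_out a :: map angle (a :: l).
have uL : uniq L.
  rewrite cons_uniq (map_inj_uniq angle_inj) ul andbT.
  by apply/mapP => -[c /neq ca] /esym/eqP; rewrite (negbTE ca).
rewrite tile_lengthE ?sides_inl // (@chain_tile x q [set s in L]) //.
- by rewrite cardsE (card_uniqP uL) /= size_map.
- apply: same_tile_trans (same_tile_last_out x) _; apply: same_tile_trans xg _.
  by rewrite -(next_first_in q) fE same_tile_next.
- by rewrite inE -lE inE map_f ?orbT.
move=> s; rewrite in_set inE => /predU1P[->|/mapP[c cl ->]].
  split=> //; first exact: mem_tile_last_out.
  by left; rewrite -fE next_first_in.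
split; rewrite ?angle_inr //.
  apply: mem_tile_last_out; first exact: angle_sides.
  exact: same_tile_trans xg (same _ cl).
right; rewrite -/(angle_out c) in_set inE.
move: cl; rewrite inE => /predU1P[->|cl]; first by rewrite eqxx.
have [d dl] := path_prev pl cl; rewrite forbidden_stepE => /eqP <-.
by rewrite map_f ?orbT.
Qed.

(** The point q is where the walk from [last_out x] comes back to the boundary. The clause on
    valency zero carries the sign along; q is then the other end of the only diagonal. *)
Lemma next_forbiddenP x H : based_at x H -> exists q, let F := next_forbidden H in
  [/\ occupied q /\ same_tile T (inl (ord_pred x)) (inl q),
      val (thread_src F : tiling_vertex T) = diag (first_in q),
      forall b, (first_arrow F == Some b) = (angle_out b == first_in q),
      valency (thread_src F) = 0 -> tail (first_in q) = x /\
        thread_sign F = end_sign (thread_src F) x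
    & (size (thread_arrows F)).+1 = tile_length T (tile_of (inl (ord_pred x)))].
Proof.
move=> B; have ox := based_occupied B; have oi := last_out_inr ox.
have oT := last_out_sides x; have tE := based_tgt B.
(* H arrives on the face [rev_side (last_out x)], so the opposite direction is the face in the tile
   of the segment before x. *)
have tgtE a : (tgt a == thread_tgt H) && (final_arrow H != Some a) =
    (angle a == last_out x).
  rewrite (based_final B) -val_eqE [X in _ == X]tE angle_tgt //.
  case: (eqVneq (angle a) (last_out x)) => [->|_] /=; last by case: eqP.
  by rewrite rev_side_neq.
rewrite /next_forbidden; case: pickP => [b|no].
  rewrite tgtE => /eqP bx.
  have nb c : ~~ forbidden_step b c.
    by rewrite forbidden_stepE bx eq_sym angle_out_last_out.
  case: pickP => [F /andP[fF /eqP bF]|no]; last first.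
    by have [F hF] := forbidden_thread_ex nb; have := no F; rewrite hF.
  case E : (thread_arrows F) => [|a l]; first by rewrite /final_arrow E in bF.
  have [m sE _ _] := is_thread_cons fF E.
  have lb : angle (last a l) = last_out x.
    by move: bF; rewrite (final_arrow_cons E) => -[->].
  have [q [qE xq len]] := forbidden_path_tile ox m lb.
  exists q => /=; split=> //.
  - split=> //; rewrite -[occupied q]negbK -first_in_inl qE.
    exact: angle_out_inr.
  - by rewrite sE qE diag_angle_out.
  - move=> c; rewrite (first_arrow_cons E) qE (inj_eq angle_out_inj) eq_sym.
    by apply/eqP/eqP => [[]|->].
  - by move=> v0; have := valency0_from a v0; rewrite sE inE eqxx.
(* Without such an arrow, [last_out x] is the only diagonal of its tile and the forbidden thread is
   trivial. *)
have no' e : angle e != last_out x by have := no e; rewrite tgtE => ->.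
have ni : is_inl (next_side (last_out x)).
  apply/negPn/negP => i; have [e eE] := angle_ex oT oi i.
  by have := no' e; rewrite eE eqxx.
have fE := first_inE oT ni; set q := head _ in fE.
have xq : same_tile T (inl (ord_pred x)) (inl q).
  apply: same_tile_trans (same_tile_last_out x) _.
  by rewrite -(next_first_in q) fE same_tile_next.
exists q => /=; split=> //.
- by split=> //; rewrite -[occupied q]negbK -first_in_inl fE.
- by rewrite fE -tE.
- by move=> b; rewrite fE (negbTE (angle_out_last_out _ _)).
- move=> v0; rewrite fE tail_last_out; split; first by [].
  rewrite /thread_sign /thread_src /= -/(thread_sign H) (based_sign B).
  suff -> : thread_src H = thread_tgt H by [].
  case E : (thread_arrows H) => [|a l]; first by rewrite /thread_tgt E.
  have := valency0_into (last a l) v0.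
  by have [_ _ -> _] := is_thread_cons (based_permitted B) E; rewrite inE eqxx.
rewrite tile_lengthE ?sides_inl // (@chain_tile x q [set last_out x]) ?cards1 //.
  by rewrite inE.
move=> s /set1P ->; split=> //.
  by apply: mem_tile_last_out => //; apply: same_tile_refl.
by left; rewrite -fE next_first_in.
Qed.

Lemma AG_step_based x H : based_at x H -> exists2 q, based_at q (AG_step H) &
  same_tile T (inl (ord_pred x)) (inl q) /\
  (size (thread_arrows (next_forbidden H))).+1 =
    tile_length T (tile_of (inl (ord_pred x))).
Proof.
move=> B; have [q] := next_forbiddenP B; rewrite /AG_step.
move: (next_forbidden H) => F [[oq xq] sE fE v0 len]; exists q => //.
have qi := first_in_inr oq; have qT := first_in_sides q.
have srcE a : (src a == thread_src F) && (first_arrow F != Some a) =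
    (angle_out a == rev_side (first_in q)).
  rewrite fE -val_eqE [X in _ == X]sE angle_src //.
  case: (eqVneq (angle_out a) (first_in q)) => [->|_] /=; last by case: eqP.
  by rewrite (negbTE (rev_side_neq _ _)).
have [H' B'] := based_at_ex oq.
rewrite /next_permitted; case: pickP => [b|no].
  rewrite srcE => bq; case: pickP => [G /andP[pG /eqP bG]|no]; last first.
    have := no H'; rewrite (based_permitted B') (based_first B') bq //.
  have [y By] := based_ex pG; have := based_first By b.
  rewrite bG eqxx (eqP bq) => /esym/eqP/(can_inj rev_sideK)/first_in_inj e.
  by rewrite -e in By.
suff <- : H' = trivial_thread (thread_src F)
  ((valency (thread_src F) == 0) && ~~ thread_sign F) by [].
have sF : thread_src H' = thread_src F.
  by apply: val_inj; rewrite [LHS](based_src B') sE.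
apply: thread_eq => //=.
- case E : (thread_arrows H') => [|a l] //.
  have := no a; rewrite srcE -(based_first B') (first_arrow_cons E).
  by rewrite eqxx.
(* At valency zero the step goes to the other end of the diagonal, and the sign, which compares the
   two ends, is negated. *)
- rewrite (based_sign B') sF /end_sign.
  case: eqP => //= vF; have [qx ->] := v0 vF.
  have h1 := end_sign_head qT qi (esym sE).
  have rT : rev_side (first_in q) \in sides T by rewrite mem_rev_side.
  have ri : ~~ is_inl (rev_side (first_in q)) by rewrite is_inl_rev.
  have h2 := @end_sign_head (thread_src F) _ rT ri (etrans (diag_rev _) (esym sE)).
  move: h1 h2; rewrite head_rev // tail_rev // head_first_in qx vF /=.
  rewrite /end_sign vF /= => -> ->.
  have xq' : (x : nat) != q.
    rewrite -qx -{2}(head_first_in q); case: (first_in q) qT qi => [//|[y z]].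
    by rewrite sides_inr => /joined_neq; rewrite -val_eqE.
  by rewrite -leqNgt [RHS]leq_eqVlt (negbTE xq').
Qed.

(** * The AG-invariant *)

Definition permitted_threads := [set H : thread A | permitted_thread H].

(** Each step goes to the preceding occupied point, so it cannot jump over the base point y of
    another thread: the clockwise distance from y drops until y is reached. *)
Lemma orbit_AG_step H : permitted_thread H ->
  [set H' in orbit (@AG_step k A) H] = permitted_threads.
Proof.
move=> pH; have [x B] := based_ex pH; apply/setP => H'; rewrite !in_set.
rewrite -fconnect_orbit; apply/idP/idP => [/iter_findex <-|pH'].
  elim: (findex _ _ _) => //= m pm; have [y By] := based_ex pm.
  by have [q Bq _] := AG_step_based By; apply: based_permitted Bq.
have [y B'] := based_ex pH'.
have [m] := ubnP (cwdist y x); elim: m x H {pH} B => // m IH x H B l.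
case: (eqVneq x y) => [xy|xy]; first by subst y; rewrite (based_uniq B' B) connect0.
have [q Bq [xq _]] := AG_step_based B.
apply: connect_trans (fconnect1 _ _) (IH q _ Bq _).
have := same_tile_pred_occupied xq (based_occupied B) (based_occupied B').
by move: xy l; rewrite -val_eqE /=; clear; cwlia.
Qed.

Lemma AG_runsE : AG_runs A = [set permitted_threads].
Proof.
have [x0 [y0 /occupied_joined /based_at_ex[H0 B0]]] := joined_ex.
apply/setP => S; rewrite in_set1; apply/imsetP/eqP => [[H pH ->]|->].
  by rewrite orbit_AG_step //; rewrite inE in pH.
exists H0; first by rewrite inE; apply: based_permitted B0.
by rewrite orbit_AG_step //; apply: based_permitted B0.
Qed.

Lemma occupied_threads : exists f : thread A -> 'I_n,
  [/\ {in permitted_threads &, injective f},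
      f @: permitted_threads = [set x | occupied x]
    & {in permitted_threads, forall H, based_at (f H) H}].
Proof.
have [x0 _] := joined_ex.
pose f H := odflt x0 [pick x | `[< based_at x H >]].
have fP : {in permitted_threads, forall H, based_at (f H) H}.
  move=> H; rewrite inE => /based_ex[x B]; rewrite /f.
  by case: pickP => [y /asboolP //|/(_ x)/negbT/negP[]]; apply/asboolP.
exists f; split=> //.
  move=> H H' pH pH' e; have B := fP _ pH; rewrite e in B.
  exact: based_uniq B (fP _ pH').
apply/setP => x; rewrite in_set; apply/imsetP/idP => [[H /fP/based_occupied + ->] //|].
move=> /based_at_ex[H B]; have pH : H \in permitted_threads.
  by rewrite inE; apply: based_permitted B.
by exists H => //; apply: based_inj B (fP _ pH).
Qed.

Lemma card_permitted_threads : #|permitted_threads| = #|open_tiles T|.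
Proof.
have [f [fi fE _]] := occupied_threads.
rewrite -(card_in_imset fi) fE open_tilesE card_in_imset ?cardsE //.
exact: tile_of_pred_inj.
Qed.

Lemma sum_forbidden_threads :
  (\sum_(H in permitted_threads) (size (thread_arrows (next_forbidden H))).+1 =
   \sum_(tau in open_tiles T) tile_length T tau)%N.
Proof.
have [f [fi fE fP]] := occupied_threads.
transitivity (\sum_(x in [set x | occupied x]) tile_length T (tile_of (inl (ord_pred x)))).
  rewrite -fE big_imset //=; apply: eq_bigr => H /fP /AG_step_based[q _ [_ ->]].
  by [].
rewrite open_tilesE big_imset /=; last exact: tile_of_pred_inj.
by apply: eq_bigl => x; rewrite inE.
Qed.

(** * Full cycles and closed tiles *)

Lemma closed_tile_inr s u :
  closed_tile (tile_of s) -> u \in tile_of s -> ~~ is_inl u.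
Proof. by move=> /forallP cl; case: u => // i; rewrite (negbTE (cl i)). Qed.

Lemma closed_tile_length s : s \in sides T -> closed_tile (tile_of s) ->
  tile_length T (tile_of s) = #|tile_of s|.
Proof.
move=> sT cl; rewrite tile_lengthE //; apply: eq_card => u; rewrite in_set.
by case: (boolP (u \in _)) => // /(closed_tile_inr cl) ->.
Qed.

Lemma angle_cycle_same_tile a l e : cycle (@forbidden_step k A) (a :: l) ->
  e \in a :: l -> same_tile T (angle a) (angle e).
Proof.
rewrite [cycle _ _]/= => pl el.
have {el}: e \in a :: rcons l a by rewrite inE mem_rcons el orbT.
move: e; apply: (@path_closed _ _ (fun e => same_tile T (angle a) (angle e)) a _ _ pl).
- move=> d d'; rewrite forbidden_stepE => /eqP dd' ad; apply: same_tile_trans ad _.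
  by rewrite dd' same_tile_sym same_tile_angle.
- exact: same_tile_refl.
Qed.

(** The side following an angle of the cycle is the angle of the preceding arrow, so these sides are
    closed under the walk and exhaust the tile. *)
Lemma angle_cycle_tile a l : cycle (@forbidden_step k A) (a :: l) ->
  [set s in map angle (a :: l)] = tile_of (angle a).
Proof.
move=> cs; apply: tile_of_next_closed.
- by rewrite in_set map_f ?mem_head.
- apply/subsetP => t; rewrite in_set => /mapP[e el ->].
  by rewrite mem_tile_of angle_sides; apply: angle_cycle_same_tile cs el.
move=> t; rewrite !in_set => /mapP[e el ->]; rewrite -/(angle_out e).
have := prev_cycle cs el; have : prev (a :: l) e \in a :: l.
  by rewrite mem_prev.
move: (prev _ _) => e' e'l; rewrite forbidden_stepE => /eqP <-.
exact: map_f.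
Qed.

Lemma orbit_next_tile s : s \in sides T -> tile_of s = [set t in orbit next_side s].
Proof.
move=> sT; apply/esym/tile_of_next_closed.
- by rewrite inE -fconnect_orbit connect0.
- apply/subsetP => u; rewrite in_set -fconnect_orbit => /iter_findex <-.
  elim: (findex _ _ _) => [|p]; first by rewrite mem_tile_of sT same_tile_refl.
  rewrite !mem_tile_of => /andP[uT su] /=; rewrite mem_next_side uT.
  exact: same_tile_trans su (same_tile_next uT).
- move=> u; rewrite !in_set -!fconnect_orbit => su.
  exact: connect_trans su (fconnect1 _ _).
Qed.

Lemma angle_map_ex (L : seq (side n)) :
  (forall u, u \in L -> [/\ u \in sides T, ~~ is_inl u & ~~ is_inl (next_side u)]) ->
  exists l : seq (arrow A), map angle l = L.
Proof.
elim: L => [|u r IH] rL; first by exists [::].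
have [|l lE] := IH; first by move=> t tr; apply: rL; rewrite inE tr orbT.
have [uT ui ni] := rL u (mem_head _ _); have [a aE] := angle_ex uT ui ni.
by exists (a :: l); rewrite /= aE lE.
Qed.

Lemma cycle_angle l : cycle (@forbidden_step k A) l =
  cycle (fun s t => s == next_side t) (map angle l).
Proof.
case: l => // a l; rewrite [LHS]/= [RHS]/= -map_rcons path_map.
by apply: eq_path => e f; rewrite forbidden_stepE.
Qed.

Lemma closed_tile_cycle s : s \in sides T -> closed_tile (tile_of s) ->
  exists l, [/\ 0 < size l, uniq l, cycle (@forbidden_step k A) l
    & size l = #|tile_of s|].
Proof.
move=> sT cl; have orb := orbit_next_tile sT.
have LP u : u \in orbit next_side s -> u \in tile_of s by rewrite orb inE.
have nL u : u \in orbit next_side s -> next_side u \in orbit next_side s.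
  by rewrite -!fconnect_orbit => su; apply: connect_trans su (fconnect1 _ _).
(* The orbit is reversed because arrows go against the walk. *)
have [|l lE] := @angle_map_ex (rev (orbit next_side s)).
  move=> u; rewrite mem_rev => uL; split.
  - by move/LP: uL; rewrite mem_tile_of => /andP[].
  - exact: closed_tile_inr cl (LP _ uL).
  - exact: closed_tile_inr cl (LP _ (nL _ uL)).
exists l; split.
- by rewrite -(size_map angle) lE size_rev size_orbit order_gt0.
- by rewrite -(map_inj_uniq angle_inj) lE rev_uniq orbit_uniq.
- rewrite cycle_angle lE rev_cycle.
  rewrite (eq_cycle (e' := frel next_side)) => [|t t' /=]; last by rewrite eq_sym.
  exact: cycle_orbit next_side_inj _.
- rewrite -(size_map angle) lE size_rev orb cardsE.
  by rewrite (card_uniqP (orbit_uniq _ _)).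
Qed.

Lemma full_cycle_closed_tile (m : nat) :
  (exists2 C, C \in full_cycles A & #|C| = m) <->
  (exists2 tau, tau \in closed_tiles T & tile_length T tau = m).
Proof.
rewrite card_full_cycleP; split=> [[l [l0 ul cs <-]]|[tau]].
  case: l l0 ul cs => [//|a l] _ ul cs; have tE := angle_cycle_tile cs.
  have cl : closed_tile (tile_of (angle a)).
    apply/forallP => i; rewrite -tE in_set; apply/mapP => -[e _ ie].
    by have := angle_inr e; rewrite -ie.
  exists (tile_of (angle a)); first by rewrite in_set cl tile_of_tiles ?angle_sides.
  rewrite closed_tile_length ?angle_sides // -tE cardsE -(size_map angle).
  by apply/card_uniqP; rewrite (map_inj_uniq angle_inj).
rewrite in_set => /andP[/tilesP[s sT ->] cl] <-.
by rewrite closed_tile_length //; apply: closed_tile_cycle.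
Qed.

(** There is a single run, and each of its threads contributes the length of its tile minus one; the
    sum is stated without subtraction of natural numbers. *)
Lemma AG_tiling : exists b : nat,
  AG A = (#|open_tiles T|, b) ::
    [seq (0, #|C|) | C : {set arrow A} <- enum (full_cycles A)] /\
  (b + #|open_tiles T| = \sum_(tau in open_tiles T) tile_length T tau)%N.
Proof.
exists (\sum_(H in permitted_threads) size (thread_arrows (next_forbidden H))); split.
  by rewrite /AG AG_runsE enum_set1 /= /run_pair card_permitted_threads.
rewrite -sum_forbidden_threads -card_permitted_threads -sum1_card -big_split /=.
by apply: eq_bigr => H _; rewrite addn1.
Qed.

(** This tells the pair of the run apart from the pairs (0, c) of the cycles. *)
Lemma open_tiles_gt0 : 0 < #|open_tiles T|.
Proof.
have [x [y /occupied_joined ox]] := joined_ex.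
rewrite open_tilesE; apply/card_gt0P.
by exists (tile_of (inl (ord_pred x))); apply: imset_f.
Qed.

End Tiling.

Local Open Scope ring_scope.

Theorem corollary4p7 (k : closedFieldType) (n : nat) (T : {set diagonal n})
    (n_ge2 : (2 <= n)%N) (tilT : is_tiling T)
    (connT : connected_quiver (tiling_quiver T)) :
  (forall c : nat,
     ((0%N, c) \in AG (tiling_algebra T k)) <->
     (exists2 tau, tau \in closed_tiles T & tile_length T tau = c)) /\
  (exists a b : nat,
     [/\ [seq p <- AG (tiling_algebra T k) | p.1 != 0%N] = [:: (a, b)],
         a = #|open_tiles T|,
         b%:Z = \sum_(tau in open_tiles T) ((tile_length T tau)%:Z - 1)
       & b%:Z = - a%:Z + \sum_(tau in open_tiles T) (tile_length T tau)%:Z]).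
Proof.
have [b [-> bE]] := AG_tiling n_ge2 tilT connT k.
have a0 := open_tiles_gt0 n_ge2 tilT connT.
have sumE : b%:Z = - #|open_tiles T|%:Z +
    \sum_(tau in open_tiles T) (tile_length T tau)%:Z.
  rewrite -(big_morph Posz PoszD (erefl (Posz 0))) -bE PoszD.
  by rewrite addrCA addNr addr0.
split=> [c|].
  rewrite -(full_cycle_closed_tile n_ge2 tilT k) inE xpair_eqE [(0 == _)%N]eq_sym.
  rewrite (gtn_eqF a0) /=; split=> [/mapP[C]|[C CA <-]].
    by rewrite mem_enum => CA [->]; exists C.
  by apply/mapP; exists C; rewrite ?mem_enum.
exists #|open_tiles T|, b; split=> //.
(* All pairs after the first come from cycles and are filtered out. *)
- rewrite /= -lt0n a0; congr cons.
  by elim: (enum _).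
- by rewrite sumE sumrB sumr_const addrC; congr (_ - _); rewrite -natz.
Qed.
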